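(* Let $a<b$ be real numbers, $\delta(x)=\min\{b-x,x-a\}$ for $x\in[a,b]$, and $\delta_0=\frac{b-a}{2}$. Let $g$ be an absolutely continuous function on $[a,b]$ such that $g(a)=g(b)=0$. (i) If $m>1$, $\nu\in[0,1/m]$ and $\lambda\in\left[0,\frac{1+\nu m}{2}\right)$, then $$\frac{1-\nu^2m^2}{4}\int_a^b\frac{|g(x)|^2}{\delta(x)^2}\,dx+\frac{c_\nu^2(m)+(m-1)(\lambda-\lambda^2)}{\delta_0^m}\int_a^b\frac{|g(x)|^2}{\delta(x)^{2-m}}\,dx\le4\left(\frac{1+\nu m}{2}-\lambda^2\right)\int_a^b|g'(x)|^2\,dx.$$ (ii) If $m>0$, $\nu\in[0,1/m)$ and $\lambda\le0$, then $$\frac{1-\nu^2m^2}{4}\int_a^b\frac{|g(x)|^2}{\delta(x)^2}\,dx+\frac{c_\nu^2(m)}{\delta_0^m}\int_a^b\frac{|g(x)|^2}{\delta(x)^{2-m}}\,dx\le\left(2(1+\nu m)+|\lambda|\right)\int_a^b|g'(x)|^2\,dx.$$ Here $c_\nu(m)$ (which depends on $\lambda$) is the number satisfying $$(1-2\lambda)J_\nu\left(\tfrac{2}{m}c_\nu(m)\right)+2c_\nu(m)J_\nu'\left(\tfrac{2}{m}c_\nu(m)\right)=0\quad\text{and}\quad \tfrac{2}{m}c_\nu(m)\in(0,j_\nu).$$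
   Context: $J_\nu$ is the Bessel function of the first kind of order $\nu$, $J_\nu'$ its derivative, and $j_\nu$ the first positive zero of $J_\nu$; $c_\nu(m)$ is taken to be the first such root. *)

(* Defs.v *)
From HB Require Import structures.
From mathcomp Require Export all_boot all_order all_algebra.
From mathcomp Require Export all_classical all_reals all_analysis.

Set Implicit Arguments.
Unset Strict Implicit.
Unset Printing Implicit Defensive.

Export Order.TTheory GRing.Theory Num.Theory.
Export numFieldNormedType.Exports.

Local Open Scope classical_set_scope.
Local Open Scope ring_scope.

(** Absolute continuity of [g] on [[a, b]]; only the values of [g] on [[a, b]]
    matter. *)
Definition abs_cont (R : realType) (a b : R) (g : R -> R) : Prop :=
  forall e : R, 0 < e -> exists2 d : R, 0 < d &
    forall (n : nat) (x y : 'I_n -> R),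
      (forall i, [/\ a <= x i, x i < y i & y i <= b]) ->
      trivIset [set: 'I_n] (fun i => `]x i, y i[%classic) ->
      \sum_(i < n) (y i - x i) < d ->
      \sum_(i < n) `|g (y i) - g (x i)| < e.

(** Euler's integral, meaningful for [0 < s]. *)
Definition Gamma (R : realType) (s : R) : R :=
  (\int[lebesgue_measure]_(t in `]0, +oo[) (t `^ (s - 1) * expR (- t)))%R.

(** Power series of [J_nu], used only for [0 <= nu] and [0 < x]: [powR] is not
    the expected power for [x < 0], and [Gamma] is not Euler's function at
    nonpositive arguments. *)
Definition besselJ (R : realType) (nu x : R) : R :=
  limn (series (fun k : nat =>
    (- 1) ^+ k / (k`!%:R * Gamma (k%:R + nu + 1)) * (x / 2) `^ (2 * k%:R + nu))).

(** [j_nu]. For [0 <= nu] the positive zeros of [J_nu] form a nonempty set,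
    closed and bounded away from [0], so that this infimum is the first one. *)
Definition bessel_zero (R : realType) (nu : R) : R :=
  inf [set x : R | 0 < x /\ besselJ nu x = 0].

(** The first root [c_nu(m)], for the parameter [lambda]. With [z = 2 c / m] the
    equation reads [(1 - 2 lambda) J_nu z + m z J_nu' z = 0]. If [0 < m],
    [0 <= nu] and [2 lambda < 1 + nu m], its left-hand side is positive for small
    [z > 0] and negative at [j_nu], so that the set below is nonempty and
    contains its infimum. *)
Definition bessel_root (R : realType) (m nu lambda : R) : R :=
  inf [set c : R | 0 < 2 / m * c < bessel_zero nu /\
    (1 - 2 * lambda) * besselJ nu (2 / m * c)
      + 2 * c * derive1 (besselJ nu) (2 / m * c) = 0].

Definition bdist (R : realType) (a b x : R) : R := Num.min (b - x) (x - a).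

(* Main.v *)
From HB Require Import structures.
Require Import Defs.
From mathcomp Require Import measurable_realfun.
From mathcomp Require Import ring lra.

(** Put [p = (1 + nu m) / 2], so that [(1 - nu^2 m^2) / 4 = p - p^2].

    Both inequalities come from one device. Let [eta] be a C^1 function on
    [(0, d]], where [d] is half the length of the interval, and let [U >= 0] be
    a weight with [U + K (eta' + eta^2) <= 0]. Expanding the square in
    [K (g' - eta g)^2 >= 0] gives [U g^2 <= K g'^2 - K (eta g^2)']. Integrate
    this on the left half, [eta] and [U] being taken at the distance to [a], and
    symmetrically on the right half. The boundary terms at [a] and [b] vanish if
    [s eta(s)] is bounded above, because [g(c)^2 <= (c - a) int_a^c g'^2]. Those
    at the midpoint have a good sign if [eta(d) >= 0], and otherwise the same
    bound on [g^2] absorbs them in the energy. This is [hardy_of_profile].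

    In (ii) the profile is the logarithmic derivative of
    [y(s) = s^(1/2) J_nu ((2 c / m) (s / d)^(m / 2))], which solves
    [y'' + ((p - p^2) / s^2 + c^2 s^(m - 2) / d^m) y = 0]; the equation defining
    [c] says that [d y'(d) / y(d) = lambda].

    In (i) the profile is elementary, [eta(s) = (1 - (s / d)^m) / (2 s)], and
    only an upper bound on the root enters, [c^2 <= (m + nu m) (p - lambda)]
    ([bessel_root_le]). With it the coefficient of the second integral is at most
    [2 p (p - lambda) + (m - 1) (p - lambda^2)], and the constant [p - lambda^2]
    of the right-hand side appears; the rest is a polynomial inequality in
    [(s / d)^m] ([weights_le_of_root_bound]).

    For the root, write [J_nu (x) = (x / 2)^nu / Gamma (nu + 1) * u (x^2 / 4)]
    with [u] entire, [u 0 = 1] and [t u'' + (nu + 1) u' + u = 0]; this takes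
    nothing more than [Gamma (s + 1) = s Gamma s]. The equation for [c] becomes
    [(p - lambda) u(t) + m t u'(t) = 0] at [t = c^2 / m^2]. As long as [u > 0],
    the differential equation and its derivative give [u' <= 0] and then
    [u'' >= 0], hence [u <= - (nu + 1) u'], which is the bound on [c].

    The energy is the integral of the square of the classical derivative, so
    absolute continuity has to be turned into the fundamental theorem of calculus
    ([abs_cont_density]). The total variation writes [g] as a difference of two
    nondecreasing absolutely continuous functions; the Lebesgue-Stieltjes measure
    of such a function is dominated by Lebesgue measure, its Radon-Nikodym density
    is integrable, and Lebesgue's differentiation theorem identifies the density
    with the derivative almost everywhere. The theorem is applied to [g] and also
    to the products [eta g^2]. *)

Set Implicit Arguments.
Unset Strict Implicit.
Unset Printing Implicit Defensive.
Local Open Scope classical_set_scope.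
Local Open Scope ring_scope.

(** * Finite families of intervals *)

Section families.
Context {R : realType}.
Implicit Types (p q : R * R) (s t : seq (R * R)) (f : R -> R).

(** A pair stands for the interval between its components; common end points are
    allowed. *)
Definition nonoverlap p q := (p.2 <= q.1) || (q.2 <= p.1).

Definition family s := all (fun p => p.1 <= p.2) s && pairwise nonoverlap s.

Definition total_length s := \sum_(p <- s) (p.2 - p.1).

Definition total_increment f s := \sum_(p <- s) `|f p.2 - f p.1|.

(** Absolute continuity on the whole line, for lists instead of indexed families:
    lists can be cut, refined and concatenated. Degenerate intervals are
    allowed, so that a family stays a family after clamping its end points. *)
Definition abs_cont_line f := forall e, 0 < e -> exists2 d, 0 < d &
  forall s, family s -> total_length s < d -> total_increment f s <= e.

Definition clamp (a b x : R) := Num.max a (Num.min x b).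

Lemma clamp_itv a b x : a <= b -> a <= clamp a b x <= b.
Proof. by move=> ab; rewrite /clamp le_max lexx ge_max ab ge_min lexx orbT. Qed.

Lemma clamp_id a b x : a <= x <= b -> clamp a b x = x.
Proof.
by move=> /andP[ax xb]; rewrite /clamp (min_idPl xb) (max_idPr ax).
Qed.

Lemma le_clamp a b x y : x <= y -> clamp a b x <= clamp a b y.
Proof.
move=> xy; rewrite /clamp ge_max !le_max lexx/=.
by rewrite le_min !ge_min lexx xy orbT !orbT.
Qed.

Lemma clamp_lip a b x y : a <= b -> x <= y ->
  clamp a b y - clamp a b x <= y - x.
Proof.
move=> ab xy; rewrite /clamp.
case: (leP x b) => ?; case: (leP y b) => ?; try lra.
- by case: (leP a x) => ?; case: (leP a y) => ?; lra.
- by case: (leP a x) => ?; case: (leP a b) => ?; lra.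
Qed.

Lemma nonoverlapC p q : nonoverlap p q = nonoverlap q p.
Proof. by rewrite /nonoverlap orbC. Qed.

Lemma total_length_cat s t : total_length (s ++ t) = total_length s + total_length t.
Proof. by rewrite /total_length big_cat. Qed.

Lemma total_length_cons p s : total_length (p :: s) = p.2 - p.1 + total_length s.
Proof. by rewrite /total_length big_cons. Qed.

Lemma total_increment_cat f s t : total_increment f (s ++ t) = total_increment f s + total_increment f t.
Proof. by rewrite /total_increment big_cat. Qed.

Lemma total_increment_cons f p s : total_increment f (p :: s) = `|f p.2 - f p.1| + total_increment f s.
Proof. by rewrite /total_increment big_cons. Qed.

(** Clamping extends the function by constants outside [[a, b]]. It may turn an
    interval into a point; these contribute nothing and are filtered out, the
    given notion being about nondegenerate intervals. *)
Lemma abs_cont_clamp a b f : a <= b -> abs_cont a b f -> abs_cont_line (f \o clamp a b).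
Proof.
move=> ab H e e0; have [d d0 Hd] := H e e0; exists d => // s /andP[os ps] lsd.
pose c (p : R * R) := (clamp a b p.1, clamp a b p.2).
pose t := [seq p <- map c s | p.1 < p.2].
have st : pairwise nonoverlap t.
  apply: pairwise_filter; rewrite pairwise_map; apply: sub_pairwise ps => p q.
  by rewrite /nonoverlap /= => /orP[]/(le_clamp a b) ->; rewrite ?orbT.
have ot p : p \in t -> [/\ a <= p.1, p.1 < p.2 & p.2 <= b].
  rewrite mem_filter => /andP[p12 /mapP[q _ pq]]; split=> //.
    by rewrite pq /=; case/andP: (clamp_itv q.1 ab).
  by rewrite pq /=; case/andP: (clamp_itv q.2 ab).
have lt : total_length t <= total_length s.
  rewrite /total_length big_filter big_map big_seq_cond [leRHS]big_seq.
  rewrite big_mkcondr/=; apply: ler_sum => p ps'.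
  have p12 : p.1 <= p.2 by move/allP : os; apply.
  by case: ifPn => _; [exact: clamp_lip|rewrite subr_ge0].
have -> : total_increment (f \o clamp a b) s = total_increment f t.
  rewrite /total_increment big_filter big_map [RHS]big_mkcond/= !big_seq.
  apply: eq_bigr => p ps'; case: ifPn => //; rewrite -leNgt => h.
  have p12 : p.1 <= p.2 by move/allP : os; apply.
  have -> : clamp a b p.2 = clamp a b p.1.
    by apply/eqP; rewrite eq_le h le_clamp.
  by rewrite subrr normr0.
pose x (i : 'I_(size t)) := (tnth (in_tuple t) i).1.
pose y (i : 'I_(size t)) := (tnth (in_tuple t) i).2.
have -> : total_increment f t = \sum_(i < size t) `|f (y i) - f (x i)|.
  by rewrite /total_increment big_tnth.
apply/ltW/(Hd _ x y).
- by move=> i; apply: ot; exact: mem_tnth.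
- apply/trivIsetP => i j _ _ ij; apply/seteqP; split => // z/=.
  rewrite !in_itv/= => -[/andP[xz zy] /andP[xz' zy']].
  have : nonoverlap (tnth (in_tuple t) i) (tnth (in_tuple t) j).
    wlog : i j ij xz zy xz' zy' / (i < j)%N.
      move=> W; have [ltij|ltji|/val_inj eij] := ltngtP i j; first exact: W.
        by rewrite nonoverlapC; apply: W => //; rewrite eq_sym.
      by rewrite eij eqxx in ij.
    move=> ltij; rewrite !(tnth_nth (0, 0)).
    by move/pairwiseP : st => /(_ (0,0) i j); apply; rewrite ?inE ?ltn_ord.
  rewrite /nonoverlap => /orP[]; rewrite leNgt.
    by rewrite (lt_trans xz' zy).
  by rewrite (lt_trans xz zy').
- apply: le_lt_trans lsd; apply: le_trans lt.
  by rewrite /total_length [leRHS]big_tnth.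
Qed.

Lemma family_cons p s :
  family (p :: s) = [&& p.1 <= p.2, all (nonoverlap p) s & family s].
Proof. by rewrite /family /= -!andbA; congr (_ && _); rewrite andbCA. Qed.

(** Half-open intervals, as in the semiring generating the Stieltjes measures. *)
Definition covers t s := forall x, (exists2 p, p \in s & p.1 < x <= p.2) ->
  exists2 p, p \in t & p.1 < x <= p.2.

(** An interval that overlaps the new one is replaced, together with it, by their
    hull, which is no longer than the two; the family gets shorter, and
    [n] bounds its size for the induction. *)
Lemma family_insert n p s : (size s <= n)%N -> p.1 <= p.2 -> family s ->
  exists t, [/\ family t, covers t (p :: s) & total_length t <= p.2 - p.1 + total_length s].
Proof.
elim: n p s => [|n ih] p s.
  rewrite leqn0 => /nilP -> p12 _; exists [:: p]; split=> //.
  - by rewrite /family /= p12.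
  - by rewrite total_length_cons.
move=> sn p12 fs.
have [nov|/allPn[q qs qp]] := boolP (all (nonoverlap p) s).
  by exists (p :: s); split; rewrite ?family_cons ?p12 ?nov// total_length_cons.
have perm : perm_eq s (q :: rem q s) by exact: perm_to_rem.
have q12 : q.1 <= q.2 by case/andP: fs => /allP/(_ _ qs).
pose h := (Num.min p.1 q.1, Num.max p.2 q.2).
have [| | |t [ft ct lt]] := ih h (rem q s).
- by rewrite size_rem//; case: (s) sn.
- by rewrite /h /= le_max ge_min p12.
- case/andP: fs => /allP os ps; apply/andP; split.
    by apply/allP => r /mem_rem/os.
  exact: subseq_pairwise (rem_subseq _ _) ps.
exists t; split=> //.
- move=> x [r rs xr]; apply: ct.
  have [rp|] := boolP ((r == p) || (r == q)).
    exists h; first by rewrite inE eqxx.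
    by case/orP: rp xr => /eqP -> /andP[? ?]; rewrite gt_min le_max;
      apply/andP; split; apply/orP; auto.
  rewrite negb_or => /andP[rp rq]; exists r => //.
  move: rs; rewrite inE (negbTE rp)/= (perm_mem perm) inE (negbTE rq)/= => rs.
  by rewrite inE rs orbT.
- apply: le_trans lt _; rewrite /total_length (perm_big _ perm)/= big_cons addrA lerD2r.
  move: qp; rewrite /nonoverlap negb_or -!ltNge /h/= => /andP[? ?].
  by case: (leP p.2 q.2) => ?; case: (leP p.1 q.1) => ?; lra.
Qed.

(** The covers that define outer measure may overlap, whereas absolute continuity
    speaks of disjoint intervals; merging bridges the two. *)
Lemma family_merge s : all (fun p => p.1 <= p.2) s ->
  exists t, [/\ family t, covers t s & total_length t <= total_length s].
Proof.
elim: s => [_|p s ih /= /andP[p12 /ih[t [ft ct lt]]]].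
  by exists [::]; split => //; rewrite /total_length big_nil.
have [t' [ft' ct' lt']] := family_insert (leqnn _) p12 ft.
exists t'; split=> //; last by rewrite (le_trans lt')// total_length_cons lerD2l.
move=> x [q]; rewrite inE => /orP[/eqP -> xp|qs xq]; apply: ct'.
  by exists p; rewrite // inE eqxx.
have [r rt xr] := ct x (ex_intro2 _ _ q qs xq).
by exists r; rewrite // inE rt orbT.
Qed.

End families.

(** * Total variation and monotone decomposition *)

Section variation.
Context {R : realType}.
Implicit Types (p q : R * R) (s t : seq (R * R)) (f g : R -> R).

Definition partition_family (a : R) (r : seq R) := [seq (p.2, p.1) | p <- zip r (a :: r)].

Lemma partition_family_itv a r : path <%R a r ->
  all (fun p => [&& a <= p.1, p.1 <= p.2 & p.2 <= last a r]) (partition_family a r).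
Proof.
elim: r a => // x r ih a /= /andP[ax xr]; rewrite lexx (ltW ax)/=.
have xl : x <= last x r.
  have := mem_last x r; rewrite inE => /orP[/eqP ->//|].
  by move/(order_path_min lt_trans)/allP : xr => /[apply]/ltW.
rewrite xl/=; apply: sub_all (ih _ xr) => p /and3P[xp -> ->].
by rewrite (le_trans (ltW ax) xp).
Qed.

Lemma family_partition a r : path <%R a r -> family (partition_family a r).
Proof.
elim: r a => // x r ih a /= /andP[ax xr].
rewrite [partition_family _ _]/= family_cons /= (ltW ax) ih// andbT.
apply: sub_all (partition_family_itv xr) => p /and3P[xp _ _].
by rewrite /nonoverlap /= xp.
Qed.

Lemma total_length_partition a r : total_length (partition_family a r) = last a r - a.
Proof.
elim: r a => [|x r ih] a /=; first by rewrite /total_length big_nil subrr.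
by rewrite [partition_family _ _]/= total_length_cons ih/= addrC subrKA.
Qed.

Lemma total_increment_partition a b f r : itv_partition a b r ->
  total_increment f (partition_family a r) = variation a b f r.
Proof. by move=> /variation_zip ->; rewrite /total_increment big_map. Qed.

Lemma le_tvP a b f e : a <= b -> 0 <= e ->
  (forall r, path <%R a r -> last a r = b -> total_increment f (partition_family a r) <= e) ->
  (total_variation a b f <= e%:E)%E.
Proof.
move=> ab e0 H; rewrite /total_variation.
apply: ge_ereal_sup => _ [_ [r rab <-] <-]; rewrite lee_fin -total_increment_partition//.
by case: rab => ? /eqP; apply: H.
Qed.

(** Take [d] for the tolerance [1]: on an interval shorter than [d] the variation
    is at most [1], and finitely many of them cover [[a, b]]. *)
Lemma bounded_variation_of_abs_cont a b f : a <= b -> abs_cont_line f -> bounded_variation a b f.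
Proof.
move=> ab /(_ 1 ltr01)[d d0 Hd].
have TV1 (x y : R) : x <= y -> y - x < d -> (total_variation x y f <= 1)%E.
  move=> xy yxd; apply: le_tvP => // r xr ry.
  by apply: Hd; [exact: family_partition|rewrite total_length_partition ry].
have TVn n (x y : R) : x <= y -> y - x <= n%:R * (d / 2) ->
    (total_variation x y f <= n%:R%:E)%E.
  elim: n x y => [|n ih] x y xy.
    rewrite mul0r => h; have -> : x = y by lra.
    by rewrite total_variationxx.
  rewrite -natr1 mulrDl mul1r => yx; pose z := Num.min y (x + d / 2).
  have xz : x <= z by rewrite /z le_min xy; lra.
  have zy : z <= y by rewrite /z ge_min lexx.
  rewrite (total_variationD _ xz zy) addeC EFinD leeD//; last first.
    by apply: TV1 => //; rewrite /z; case: (leP y (x + d / 2)); lra.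
  apply: ih => //; rewrite /z; case: (leP y (x + d / 2)) => ?; last by lra.
  by rewrite subrr mulr_ge0//; lra.
apply/bounded_variationP => //; rewrite ge0_fin_numE ?total_variation_ge0//.
have := TVn (Num.truncn ((b - a) / (d / 2))).+1 a b ab.
move=> H; apply: le_lt_trans (H _) (ltry _).
rewrite -ler_pdivrMr; last by lra.
by apply/ltW/truncnS_gt.
Qed.

Definition tv f a b := fine (total_variation a b f).

Lemma tvK f a b : abs_cont_line f -> a <= b -> (tv f a b)%:E = total_variation a b f.
Proof.
by move=> acf ab; rewrite /tv fineK//; exact/bounded_variationP/bounded_variation_of_abs_cont.
Qed.

Lemma tvD f a b c : abs_cont_line f -> a <= b -> b <= c -> tv f a c = tv f a b + tv f b c.
Proof.
move=> acf ab bc; apply/EFin_inj; rewrite EFinD !tvK//; last exact: le_trans bc.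
exact: total_variationD.
Qed.

Lemma tv_ge f a b : abs_cont_line f -> a <= b -> `|f b - f a| <= tv f a b.
Proof.
by move=> acf ab; rewrite -lee_fin tvK//; exact: total_variation_ge.
Qed.

Lemma family_refine p s r : path <%R p.1 r -> last p.1 r = p.2 ->
  family (p :: s) -> family (s ++ partition_family p.1 r).
Proof.
move=> pr lr; rewrite family_cons => /and3P[p12 aps /andP[os ps]].
have /andP[or pwr] := family_partition pr.
rewrite /family all_cat os or pairwise_cat ps pwr !andbT/=.
apply/allrelP => q u qs /(allP (partition_family_itv pr)); rewrite lr => /and3P[h1 h2 h3].
move/allP : aps => /(_ _ qs); rewrite /nonoverlap => /orP[h|h].
  by rewrite (le_trans h3 h) orbT.
by rewrite (le_trans h h1).
Qed.

(** The intervals of [s] are replaced one after the other by arbitrary partitions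
    of themselves: the induction carries the already refined intervals in [t],
    and a supremum over partitions is taken at each step, so that the tolerance
    [e] is not spoilt. *)
Lemma sum_tv_le f e d : abs_cont_line f ->
  (forall s, family s -> total_length s < d -> total_increment f s <= e) ->
  forall s, family s -> total_length s < d -> \sum_(p <- s) tv f p.1 p.2 <= e.
Proof.
move=> acf H.
have main s t : family (s ++ t) -> total_length (s ++ t) < d ->
    \sum_(p <- s) tv f p.1 p.2 + total_increment f t <= e.
  elim: s t => [t|p s ih t]; first by rewrite big_nil add0r; exact: H.
  rewrite big_cons cat_cons => fpst lpst.
  have /and3P[p12 _ fst] : [&& p.1 <= p.2, all (nonoverlap p) (s ++ t) & family (s ++ t)].
    by rewrite -family_cons.
  suff : tv f p.1 p.2 <= e - (\sum_(p <- s) tv f p.1 p.2 + total_increment f t).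
    by rewrite lerBrDr addrA.
  rewrite -lee_fin tvK//; apply: le_tvP => //.
    by rewrite subr_ge0; apply: ih => //; move: lpst; rewrite total_length_cons; lra.
  move=> r pr lr; have := family_refine pr lr fpst; rewrite -catA => fr.
  have := ih _ fr; rewrite total_increment_cat => H1.
  rewrite -subr_ge0; have : \sum_(p0 <- s) tv f p0.1 p0.2 +
      (total_increment f t + total_increment f (partition_family p.1 r)) <= e.
    apply: H1; apply: le_lt_trans lpst.
    by rewrite total_length_cons !total_length_cat total_length_partition lr; lra.
  lra.
move=> s fs ls; have := main s [::]; rewrite cats0 /total_increment big_nil addr0.
exact.
Qed.

Lemma family_clamp a b s : family s ->
  family [seq (clamp a b p.1, clamp a b p.2) | p <- s].
Proof.
move=> /andP[os ps]; apply/andP; split.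
  by rewrite all_map; apply: sub_all os => p /(le_clamp a b).
rewrite pairwise_map; apply: sub_pairwise ps => p q.
by rewrite /nonoverlap /= => /orP[]/(le_clamp a b) ->; rewrite ?orbT.
Qed.

Lemma total_length_clamp a b s : a <= b -> family s ->
  total_length [seq (clamp a b p.1, clamp a b p.2) | p <- s] <= total_length s.
Proof.
move=> ab /andP[/allP os _]; rewrite /total_length big_map big_seq [leRHS]big_seq.
by apply: ler_sum => p /os; exact: clamp_lip.
Qed.

Lemma abs_cont_tv a b f : a <= b -> abs_cont_line f -> abs_cont_line (fun x => tv f a (clamp a b x)).
Proof.
move=> ab acf e e0; have [d d0 Hd] := acf e e0; exists d => // s fs ls.
have := sum_tv_le acf Hd (family_clamp a b fs) (le_lt_trans (total_length_clamp ab fs) ls).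
rewrite big_map; apply: le_trans; rewrite le_eqVlt; apply/orP; left.
rewrite /total_increment !big_seq; apply/eqP/eq_bigr => p ps /=.
have /(le_clamp a b) p12 : p.1 <= p.2 by case/andP: fs => /allP/(_ _ ps).
have /andP[ap _] := clamp_itv p.1 ab.
rewrite (tvD acf ap p12) addrC addKr ger0_norm//.
by rewrite -lee_fin tvK// total_variation_ge0.
Qed.

Lemma abs_cont_lineB f g : abs_cont_line f -> abs_cont_line g -> abs_cont_line (fun x => f x - g x).
Proof.
move=> acf acg e e0; have e20 : 0 < e / 2 by rewrite divr_gt0.
have [d d0 Hd] := acf _ e20; have [d' d0' Hd'] := acg _ e20.
exists (Num.min d d'); first by rewrite lt_min d0.
move=> s fs; rewrite lt_min => /andP[/(Hd _ fs) h1 /(Hd' _ fs) h2].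
rewrite (splitr e); apply: le_trans (lerD h1 h2).
rewrite /total_increment -big_split/=; apply: ler_sum => p _.
rewrite (_ : _ - _ = (f p.2 - f p.1) - (g p.2 - g p.1)); last by lra.
exact: ler_normB.
Qed.

(** The two functions are the total variation [T] and [T - g]; both are
    nondecreasing because the variation dominates the increments of [g]. *)
Lemma abs_cont_monotone_decomposition a b g : a <= b -> abs_cont a b g ->
  exists T S : R -> R, [/\ {homo T : x y / x <= y}, {homo S : x y / x <= y},
    abs_cont_line T, abs_cont_line S & forall x, g (clamp a b x) = T x - S x].
Proof.
move=> ab /(abs_cont_clamp ab) acf; pose f := g \o clamp a b.
pose T x := tv f a (clamp a b x); exists T, (fun x => T x - f x).
have TD x y : x <= y -> T y - T x = tv f (clamp a b x) (clamp a b y).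
  move=> /(le_clamp a b) xy; have /andP[ax _] := clamp_itv x ab.
  by rewrite /T (tvD acf ax xy) addrC addKr.
have fT x y : x <= y -> `|f y - f x| <= T y - T x.
  move=> xy; rewrite TD//; have := tv_ge acf (le_clamp a b xy).
  by rewrite /f /= !(clamp_id (clamp_itv _ ab)).
split.
- by move=> x y xy; rewrite -subr_ge0; apply: le_trans (fT _ _ xy).
- move=> x y xy; have := le_trans (ler_norm _) (fT _ _ xy); lra.
- exact: abs_cont_tv.
- by apply: abs_cont_lineB => //; exact: abs_cont_tv.
- by move=> x; rewrite subKr.
Qed.

End variation.

(** * The density of a monotone absolutely continuous function *)

Section monotone.
Context {R : realType}.
Notation mu := (@lebesgue_measure R).
Implicit Types (p q : R * R) (s t : seq (R * R)).

Lemma abs_cont_continuous (f : R -> R) : abs_cont_line f -> continuous f.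
Proof.
move=> acf x; apply/cvgrPdist_le => e e0; have [d d0 Hd] := acf e e0.
near=> y.
have xy : `|x - y| < d by near: y; have /cvgrPdist_lt := @cvg_id _ (nbhs x); exact.
have := Hd [:: (Num.min x y, Num.max x y)].
rewrite /family /= andbT /total_increment /total_length !big_seq1/=.
move: xy; rewrite ltr_norml => xy.
by case: (leP x y) => yx h; [rewrite distrC|]; apply: h;
  rewrite ?yx ?(ltW yx)//; lra.
Unshelve. all: by end_near. Qed.

Variable T : R -> R.
Hypothesis Tnd : {homo T : x y / x <= y}.
Hypothesis Tac : abs_cont_line T.

Let Trc : right_continuous T.
Proof. by apply: right_continuousW; exact: abs_cont_continuous. Qed.

HB.instance Definition _ := isCumulative.Build R _ R T Tnd Trc.

Notation L := (lebesgue_stieltjes_measure (T : cumulative R R)).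

Let L_itv x y : x <= y -> L `]x, y] = (T y - T x)%:E.
Proof.
move=> xy; rewrite /lebesgue_stieltjes_measure /measure_extension.
rewrite measurable_mu_extE/=; last exact: is_ocitv.
by rewrite wlength_itv_bnd.
Qed.

Definition union_oc s : set R := \big[setU/set0]_(p <- s) `]p.1, p.2]%classic.

Lemma union_ocP s x : union_oc s x <-> exists2 p, p \in s & p.1 < x <= p.2.
Proof.
rewrite /union_oc -bigcup_seq; split.
  by move=> [p /= ps]; rewrite in_itv/= => xp; exists p.
by move=> [p ps xp]; exists p => //=; rewrite in_itv/=.
Qed.

Lemma measurable_union_oc s : measurable (union_oc s).
Proof. by apply: bigsetU_measurable => p _; exact: measurable_itv. Qed.

Let L_cover s : family s -> (L (union_oc s) <= (total_increment T s)%:E)%E.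
Proof.
elim: s => [_|p s ih]; first by rewrite /union_oc /total_increment !big_nil measure0.
rewrite family_cons => /and3P[p12 _ fs].
rewrite /union_oc big_cons total_increment_cons EFinD.
apply: (le_trans (measureU2 _ _ _)).
- exact: measurable_itv.
- exact: measurable_union_oc.
rewrite leeD//; last exact: ih.
rewrite {1}[X in (X <= _)%E](L_itv p12).
by rewrite lee_fin ler_norm.
Qed.

Let L_small e d : (forall s, family s -> total_length s < d -> total_increment T s <= e) ->
  forall s, all (fun p => p.1 <= p.2) s -> total_length s < d -> (L (union_oc s) <= e%:E)%E.
Proof.
move=> H s os ls; have [t [ft cts lt]] := family_merge os.
have : union_oc s `<=` union_oc t by move=> x /union_ocP/cts/union_ocP.
move=> /(le_measure L); rewrite !inE => st.
apply: le_trans (st _ _) _; [exact: measurable_union_oc..|].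
apply: le_trans (L_cover ft) _.
by rewrite lee_fin H// (le_lt_trans lt).
Qed.

(** A Lebesgue null set has a cover by half-open intervals of total length less
    than the [d] that absolute continuity associates with [e]. Its finite parts,
    once merged, have Stieltjes measure at most [e], and so has their union. *)
Let L_null A : measurable A -> mu A = 0%E -> L A = 0%E.
Proof.
move=> mA A0; apply/eqP; rewrite eq_le measure_ge0 andbT.
apply/lee_addgt0Pr => e e0; rewrite add0e.
have [d d0 Hd] := Tac e0.
have : (mu A < d%:E)%E by rewrite A0 lte_fin.
rewrite /lebesgue_measure /lebesgue_stieltjes_measure /measure_extension /=.
rewrite /mu_ext => /ereal_inf_lt[_ [F [mF AF] <-]] Fd.
have /choice[b Fb] : forall k, exists p : R * R, p.1 <= p.2 /\ F k = `]p.1, p.2]%classic.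
  move=> k; have [->|[p p12 ->]] := (ocitvP (F k)).1 (mF k).
    by exists (0, 0); rewrite set_itv_ge ?bnd_simp ?ltxx.
  by exists p; rewrite ltW.
pose s n := [seq b k | k <- iota 0 n].
have cs n : union_oc (s n) = \big[setU/set0]_(k < n) F k.
  rewrite /union_oc /s big_map -(big_mkord xpredT F) /index_iota subn0.
  by apply: eq_bigr => k _; rewrite (Fb k).2.
have Ls n : (L (union_oc (s n)) <= e%:E)%E.
  apply: (L_small Hd).
    by rewrite all_map; apply/allP => k _; exact: (Fb k).1.
  rewrite -lte_fin; apply: le_lt_trans Fd.
  apply: le_trans (nneseries_lim_ge n _); last first.
    by move=> k _ _; exact: wlength_ge0.
  rewrite /total_length /s big_map -sumEFin /index_iota subn0 le_eqVlt; apply/orP; left.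
  apply/eqP/eq_bigr => k _; rewrite (Fb k).2 wlength_itv_bnd//.
  exact: (Fb k).1.
have mF' k : measurable (F k : set (measurableTypeR R)).
  by rewrite (Fb k).2; exact: measurable_itv.
have mU : measurable (\bigcup_k F k : set (measurableTypeR R)).
  exact: bigcupT_measurable.
apply: (@le_trans _ _ (L (\bigcup_k F k))).
  by apply: le_measure; rewrite ?inE.
have <- : \bigcup_n union_oc (s n.+1) = \bigcup_k F k.
  under eq_bigcupr do rewrite cs.
  by rewrite bigcup_bigsetU_bigcup.
have /(cvge_le _) : (L \o (fun n => union_oc (s n.+1))) n @[n --> \oo] -->
    L (\bigcup_n union_oc (s n.+1)).
  apply: nondecreasing_cvg_mu.
  - by move=> n; exact: measurable_union_oc.
  - by apply: bigcupT_measurable => n; exact: measurable_union_oc.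
  - by move=> m n mn; apply/subsetPset => x /=; rewrite !cs; exact: subset_bigsetU.
by apply; apply: nearW => n; exact: Ls.
Qed.

(** Radon-Nikodym for the Stieltjes measure, restricted to the bounded interval
    to make it finite. *)
Lemma monotone_abs_cont_density a b : a <= b -> exists w : R -> R,
  mu.-integrable setT (EFin \o w) /\
  forall x, a <= x <= b -> T x - T a = \int[mu]_(t in `[a, x]) w t.
Proof.
move=> ab; pose D : set (measurableTypeR R) := `]a, b]%classic.
have mD : measurable D by exact: measurable_itv.
have Doo : (L D < +oo)%E by rewrite /D L_itv// ltry.
pose nu := mfrestr mD Doo.
have dom : charge_of_finite_measure nu `<< mu.
  apply/null_content_dominatesP => A mA A0.
  rewrite /charge_of_finite_measure /nu /mfrestr /mrestr.
  apply: L_null; first exact: measurableI.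
  by apply/eqP; rewrite eq_le measure_ge0 andbT -A0 le_measure ?inE//; exact: measurableI.
pose w := fine \o (Radon_Nikodym (charge_of_finite_measure nu) mu).
have wE : EFin \o w = (Radon_Nikodym (charge_of_finite_measure nu) mu).
  apply/funext => x; rewrite /w /= fineK//; exact: Radon_Nikodym_fin_num.
have iw : mu.-integrable setT (EFin \o w).
  by rewrite wE; exact: Radon_Nikodym_integrable.
exists w; split => // x /andP[ax xb]; apply: EFin_inj; rewrite -L_itv//.
rewrite -Rintegral_itv_obnd_cbnd; last exact: integrableS iw.
have mI : measurable (`]a, x] : set (measurableTypeR R)) by exact: measurable_itv.
rewrite /Rintegral fineK; last first.
  by apply: integrable_fin_num => //; exact: integrableS iw.
transitivity (charge_of_finite_measure nu `]a, x]).
  rewrite /charge_of_finite_measure /nu /mfrestr /mrestr; congr (L _).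
  by apply/esym/setIidl => t; rewrite /D /= !in_itv/= => /andP[-> /le_trans ->].
rewrite (Radon_Nikodym_integral dom mI); apply: eq_integral => t _.
by rewrite -wE.
Qed.

End monotone.

(** * The fundamental theorem for absolutely continuous functions *)

Section density.
Context {R : realType}.
Notation mu := (@lebesgue_measure R).

(** The fundamental theorem of calculus for absolutely continuous functions. *)
Theorem abs_cont_density (a b : R) g : a < b -> abs_cont a b g ->
  exists w : R -> R, [/\ mu.-integrable setT (EFin \o w),
    forall x, a <= x <= b -> g x - g a = \int[mu]_(t in `[a, x]) w t &
    {ae mu, forall x, a < x < b -> derivable g x 1 /\ derive1 g x = w x}].
Proof.
move=> ab gac.
have [T [S [Tnd Snd Tac Sac gTS]]] := abs_cont_monotone_decomposition (ltW ab) gac.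
have [u [iu Tu]] := monotone_abs_cont_density Tnd Tac (ltW ab).
have [v [iv Sv]] := monotone_abs_cont_density Snd Sac (ltW ab).
pose w x := u x - v x.
have iw : mu.-integrable setT (EFin \o w).
  rewrite (_ : EFin \o w = (EFin \o u) \- (EFin \o v))%E; first exact: integrableB.
  by apply/funext => x; rewrite /= EFinB.
have gw x : a <= x <= b -> g x - g a = \int[mu]_(t in `[a, x]) w t.
  move=> axb; have aab : a <= a <= b by rewrite lexx ltW.
  have := gTS x; have := gTS a; rewrite !clamp_id// => -> ->.
  rewrite RintegralB//; [|exact: integrableS iu|exact: integrableS iv].
  by rewrite -Tu// -Sv//; ring.
exists w; split => //.
have li : locally_integrable [set: R] w.
  by apply: open_integrable_locally => //; exact: openT.
have ia y : mu.-integrable `[a, y] (EFin \o w) by exact: integrableS iw.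
have := @FTC1 R w (BLeft a) ia li.
apply: filterS; first exact: (ae_filter_ringOfSetsType mu).
move=> x + /andP[ax xb]; rewrite /= lte_fin => /(_ ax).
set F := fun _ => _; move=> [dF FE].
have nearE : \forall y \near x, F y + g a = g y.
  near=> y; rewrite /F -gw ?subrK//; apply/andP; split; apply/ltW; near: y.
    exact: lt_nbhsr. exact: lt_nbhsl.
have dG : is_derive x 1 g (w x).
  apply: near_eq_is_derive nearE _.
  rewrite -[w x]addr0; apply: is_deriveD.
  by apply: DeriveDef => //; rewrite -derive1E.
by split; [case: dG|rewrite derive1E; case: dG].
Unshelve. all: by end_near. Qed.
End density.

(** * The Riccati inequality on a segment *)

Section riccati.
Context {R : realType}.
Notation mu := (@lebesgue_measure R).

Lemma bounded_segment (c e : R) (f : R -> R) :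
  (forall x, c <= x <= e -> {for x, continuous f}) ->
  exists2 M, 0 < M & forall x, c <= x <= e -> `|f x| <= M.
Proof.
move=> cf; have cfw : {within `[c, e], continuous f}.
  apply: continuous_in_subspaceT => x; rewrite inE/= in_itv/=; exact: cf.
have /compact_bounded[M [_ H]] := continuous_compact cfw (@segment_compact _ c e).
exists (`|M| + 1); first by rewrite ltr_wpDl.
move=> x cxe; apply: H; first by rewrite (le_lt_trans (ler_norm M))// ltrDl.
by exists x => //=; rewrite in_itv.
Qed.

Lemma abs_cont_sub (a b c e : R) g : a <= c -> e <= b -> abs_cont a b g -> abs_cont c e g.
Proof.
move=> ac eb gac eps eps0; have [d d0 Hd] := gac eps eps0; exists d => //.
move=> n x y Hxy; apply: Hd => i; have [h1 h2 h3] := Hxy i.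
by split => //; [exact: le_trans h1|exact: le_trans h3 eb].
Qed.

Lemma abs_cont_lipschitz (c e C : R) g G : abs_cont c e g -> 0 < C ->
  (forall x y, c <= x -> x < y -> y <= e ->
    `|G y - G x| <= C * (`|g y - g x| + (y - x))) -> abs_cont c e G.
Proof.
move=> gac C0 H eps eps0.
have e0 : 0 < eps / C / 2 by rewrite !divr_gt0.
have [d d0 Hd] := gac _ e0.
exists (Num.min d (eps / C / 2)); first by rewrite lt_min d0.
move=> n x y Hxy tr; rewrite lt_min => /andP[ld le].
have h1 := Hd n x y Hxy tr ld.
apply: (@le_lt_trans _ _ (\sum_(i < n) C * (`|g (y i) - g (x i)| + (y i - x i)))).
  by apply: ler_sum => i _; have [? ? ?] := Hxy i; exact: H.
rewrite -mulr_sumr big_split/= -ltr_pdivlMl// mulrC [X in _ < X]splitr.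
exact: ltrD.
Qed.

Variables (a b : R) (g w : R -> R).
Hypothesis gc : continuous g.
Hypothesis gac : abs_cont a b g.
Hypothesis iw : mu.-integrable setT (EFin \o w).
Hypothesis dg : {ae mu, forall x, a < x < b -> derivable g x 1 /\ derive1 g x = w x}.
Hypothesis iw2 : mu.-integrable `]a, b[ (EFin \o (fun x => w x ^+ 2)).

Let mw : measurable_fun setT w.
Proof. by apply/measurable_EFinP; exact: measurable_int iw. Qed.

Let mg : measurable_fun setT g.
Proof. exact: continuous_measurable_fun. Qed.

Section segment.
Variables (c e : R) (psi dpsi : R -> R).
Hypotheses (ac : a <= c) (ce : c < e) (eb : e <= b).
Hypothesis Hpsi : forall x, c <= x <= e -> is_derive x 1 psi (dpsi x).
Hypothesis Cdpsi : forall x, c <= x <= e -> {for x, continuous dpsi}.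

Let G x := psi x * g x ^+ 2.

Let Cpsi x : c <= x <= e -> {for x, continuous psi}.
Proof.
by move=> /Hpsi[+ _] => /derivable1_diffP/differentiable_continuous.
Qed.

(** On [[c, e]] all of [g], [psi], [psi'] are bounded, so an increment of
    [psi g^2] is bounded by those of [g] and of the variable. *)
Lemma abs_cont_weighted_square : abs_cont c e G.
Proof.
have [M M0 HM] := @bounded_segment c e g (fun x _ => @gc x).
have [N N0 HN] := bounded_segment Cpsi.
have [N' N'0 HN'] := bounded_segment Cdpsi.
apply: (@abs_cont_lipschitz _ _ (2 * N * M + N' * M ^+ 2) g).
- exact: abs_cont_sub gac.
- by rewrite addr_gt0 ?mulr_gt0 ?exprn_gt0.
move=> x y cx xy ye.
have cxe : c <= x <= e by rewrite cx (le_trans (ltW xy)).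
have cye : c <= y <= e by rewrite ye (le_trans cx (ltW xy)).
have psixy : `|psi y - psi x| <= N' * (y - x).
  have [t txy ->] : exists2 t, t \in `]x, y[%R & psi y - psi x = dpsi t * (y - x).
    apply: MVT => // [t|].
      rewrite in_itv/= => /andP[xt ty]; apply: Hpsi.
      by rewrite (le_trans cx (ltW xt)) (le_trans (ltW ty)).
    apply: continuous_in_subspaceT => t; rewrite inE/= in_itv/= => /andP[xt ty].
    by apply: Cpsi; rewrite (le_trans cx xt) (le_trans ty).
  rewrite normrM (gtr0_norm (x := y - x)) ?subr_gt0// ler_wpM2r ?subr_ge0 ?(ltW xy)//.
  move: txy; rewrite in_itv/= => /andP[xt ty]; apply: HN'.
  by rewrite (le_trans cx (ltW xt)) (le_trans (ltW ty)).
have -> : G y - G x = psi y * ((g y + g x) * (g y - g x)) + (psi y - psi x) * g x ^+ 2.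
  by rewrite /G; ring.
have gx := HM _ cxe; have gy := HM _ cye; have py := HN _ cye.
apply: le_trans (ler_normD _ _) _.
have h1 : `|psi y * ((g y + g x) * (g y - g x))| <= 2 * N * M * `|g y - g x|.
  rewrite !normrM mulrA ler_wpM2r//.
  have -> : 2 * N * M = N * (M + M) by ring.
  by rewrite ler_pM// (le_trans (ler_normD _ _))// lerD.
have h2 : `|(psi y - psi x) * g x ^+ 2| <= N' * M ^+ 2 * (y - x).
  rewrite normrM normrX mulrAC ler_pM// ?exprn_ge0//.
  by rewrite lerXn2r// nnegrE// ltW.
apply: le_trans (lerD h1 h2) _; rewrite -subr_ge0.
rewrite (_ : _ - _ = 2 * N * M * (y - x) + N' * M ^+ 2 * `|g y - g x|); last by ring.
by rewrite addr_ge0// mulr_ge0 ?subr_ge0 ?(ltW xy)// ?normr_ge0// !mulr_ge0// ?exprn_ge0 // ltW.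
Qed.

Let W x := dpsi x * g x ^+ 2 + 2 * (psi x * g x * w x).

Let meas_in (f : R -> R) : (forall x, c <= x <= e -> {for x, continuous f}) ->
  measurable_fun `]c, e[ f.
Proof.
move=> cf; apply: open_continuous_measurable_fun; first exact: interval_open.
by move=> x; rewrite inE/= in_itv/= => /andP[cx xe]; apply: cf; rewrite !ltW.
Qed.

Let mW : measurable_fun `]c, e[ W.
Proof.
apply: measurable_funD.
  by apply: measurable_funM; [exact: meas_in|exact/measurable_funX/measurable_funTS].
apply: measurable_funM => //; apply: measurable_funM; last exact: measurable_funTS.
by apply: measurable_funM; [exact: meas_in|exact: measurable_funTS].
Qed.

(** The fundamental theorem gives some density of [psi g^2]; wherever both
    derivatives exist it is the one of the product rule. *)
Lemma weighted_square_FTC : mu.-integrable `]c, e[ (EFin \o W) /\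
  \int[mu]_(x in `]c, e[) W x = G e - G c.
Proof.
have [u [iu Gu du]] := abs_cont_density ce abs_cont_weighted_square.
have iu' : mu.-integrable `]c, e[ (EFin \o u) by exact: integrableS iu.
have mu' := measurable_int _ iu'.
have uW : ae_eq mu `]c, e[%classic (EFin \o u) (EFin \o W).
  move: du dg; apply: filterS2; first exact: (ae_filter_ringOfSetsType mu).
  move=> x dGx dgx; rewrite /= in_itv/= => cxe; congr EFin.
  have [_ <-] := dGx cxe.
  have [cx xe] := andP cxe.
  have [|dg1 dg2] := dgx; first by rewrite (le_lt_trans ac cx) (lt_le_trans xe eb).
  have Dg : is_derive x 1 g (w x) by apply: DeriveDef => //; rewrite -derive1E.
  have Dp : is_derive x 1 psi (dpsi x) by apply: Hpsi; rewrite !ltW.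
  rewrite derive1E /W.
  have -> : G = psi * (g * g) by apply/funext => y; rewrite /G expr2.
  rewrite derive_val.
  change (psi x * (g x * w x + g x * w x) + g x * g x * dpsi x =
    dpsi x * g x ^+ 2 + 2 * (psi x * g x * w x)); ring.
split.
  have mW' : measurable_fun `]c, e[ (EFin \o W) by exact/measurable_EFinP.
  apply/integrableP; split => //; have /integrableP[_] := iu'; apply: le_lt_trans.
  rewrite le_eqVlt; apply/orP; left; apply/eqP/ae_eq_integral.
  - exact: measurable_itv.
  - exact: measurableT_comp.
  - exact: measurableT_comp.
  - by apply: filterS uW => x /[swap] Dx /(_ Dx) ->.
rewrite Gu ?lexx ?(ltW ce)//.
have mI : measurable (`]c, e[ : set (measurableTypeR R)) by exact: measurable_itv.
rewrite -Rintegral_itv_obnd_cbnd; last exact: integrableS iu.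
rewrite -Rintegral_itv_bndo_bndc; last exact: integrableS iu.
congr fine; apply/esym/ae_eq_integral => //; exact/measurable_EFinP.
Qed.

Variables (K : R) (V : R -> R).
Hypothesis K0 : 0 < K.
Hypothesis mV : measurable_fun `]c, e[ V.
Hypothesis V0 : forall x, c < x < e -> 0 <= V x.
Hypothesis HV : forall x, c < x < e -> V x + K * (dpsi x + psi x ^+ 2) <= 0.

(** The integrand inequality is [K (w - psi g)^2 >= 0] expanded, where the product
    rule turns [2 psi g w] into [(psi g^2)' - psi' g^2]. *)
Lemma riccati_segment :
  (\int[mu]_(x in `]c, e[) (V x * g x ^+ 2)%:E <=
   (K * \int[mu]_(x in `]c, e[) w x ^+ 2 - K * (G e - G c))%:E)%E.
Proof.
have [iW <-] := weighted_square_FTC.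
have mI : measurable (`]c, e[ : set (measurableTypeR R)) by exact: measurable_itv.
have iw2' : mu.-integrable `]c, e[ (EFin \o (fun x => w x ^+ 2)).
  apply: integrableS iw2 => // x /=; rewrite !in_itv/= => /andP[cx xe].
  by rewrite (le_lt_trans ac cx) (lt_le_trans xe eb).
have iKw2 : mu.-integrable `]c, e[ (EFin \o (fun x => K * w x ^+ 2)).
  by have := integrableZl mI K iw2'; exact: eq_integrable.
have iKW : mu.-integrable `]c, e[ (EFin \o (fun x => K * W x)).
  by have := integrableZl mI K iW; exact: eq_integrable.
rewrite -!RintegralZl// -RintegralB// /Rintegral fineK; last first.
  apply: integrable_fin_num => //.
  by have := integrableB mI iKw2 iKW; exact: eq_integrable.
have le x : c < x < e -> V x * g x ^+ 2 <= K * w x ^+ 2 - K * W x.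
  move=> cxe; rewrite -subr_ge0.
  have -> : K * w x ^+ 2 - K * W x - V x * g x ^+ 2 = K * (w x - psi x * g x) ^+ 2
    - (V x + K * (dpsi x + psi x ^+ 2)) * g x ^+ 2 by rewrite /W; ring.
  rewrite subr_ge0 (@le_trans _ _ 0)//; first by rewrite mulr_le0_ge0 ?HV ?sqr_ge0.
  by rewrite mulr_ge0 ?sqr_ge0 ?ltW.
apply: ge0_le_integral => //.
- by move=> x /= /[!in_itv]/= cxe; rewrite lee_fin mulr_ge0 ?sqr_ge0 ?V0.
- by apply/measurable_EFinP; apply: measurable_funM => //; exact/measurable_funX/measurable_funTS.
- apply/measurable_EFinP; apply: measurable_funB; apply: measurable_funM => //.
  exact/measurable_funX/measurable_funTS.
Qed.

End segment.
End riccati.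

(** * The Riccati inequality on an open interval *)

Section exhaustion.
Context {R : realType}.
Notation mu := (@lebesgue_measure R).

(** Monotone convergence along an exhaustion by inner intervals. *)
Lemma integral_oo_le (lo hi B : R) (f : R -> \bar R) : lo < hi ->
  measurable_fun `]lo, hi[ f -> (forall x, lo < x < hi -> (0 <= f x)%E) ->
  (forall eta, 0 < eta -> exists2 d, 0 < d & forall c e,
    lo < c < lo + d -> hi - d < e < hi -> c < e ->
    (\int[mu]_(x in `]c, e[) f x <= (B + eta)%:E)%E) ->
  (\int[mu]_(x in `]lo, hi[) f x <= B%:E)%E.
Proof.
move=> lohi mf f0 H.
pose F n : set (measurableTypeR R) := `]lo + n.+1%:R^-1, hi - n.+1%:R^-1[%classic.
have Fsub n : F n `<=` `]lo, hi[.
  move=> x; rewrite /F /= !in_itv/= => /andP[h1 h2].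
  have h3 : 0 < n.+1%:R^-1 :> R by rewrite invr_gt0.
  by rewrite (lt_trans _ h1) ?(lt_trans h2) ?ltrDl// gtrBl.
have UF : \bigcup_n F n = `]lo, hi[%classic.
  apply/seteqP; split => [x [n _ /Fsub//]|x /=].
  rewrite in_itv/= => /andP[lx xh].
  have d0 : 0 < Num.min (x - lo) (hi - x) by rewrite lt_min !subr_gt0 lx.
  have [n _ /(_ n (leqnn _))] := near_infty_natSinv_lt (PosNum d0).
  rewrite /= lt_min => /andP[h1 h2]; exists n => //.
  by rewrite /F /= in_itv/= -ltrBrDl h1 ltrBrDl -ltrBrDr h2.
have cv : (\int[mu]_(x in F n) f x)%E @[n --> \oo] --> (\int[mu]_(x in \bigcup_n F n) f x)%E.
  apply: ge0_nondecreasing_set_cvg_integral.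
  - move=> m n mn; apply/subsetPset => x; rewrite /F /= !in_itv/= => /andP[h1 h2].
    have : n.+1%:R^-1 <= m.+1%:R^-1 :> R by rewrite lef_pV2 ?posrE// ler_nat.
    move=> h3; rewrite (le_lt_trans _ h1) ?lerD2l// (lt_le_trans h2)//.
    by rewrite lerD2l lerN2.
  - by move=> n; exact: measurable_itv.
  - by move=> n; apply: measurable_funS mf => //; exact: measurable_itv.
  - by move=> n x /Fsub; rewrite /= in_itv/=; exact: f0.
rewrite -UF; apply/lee_addgt0Pr => eta eta0; have [d d0 Hd] := H _ eta0.
apply: (cvge_le _ cv); near=> n.
have n0 : 0 < n.+1%:R^-1 :> R by rewrite invr_gt0.
have nd : n.+1%:R^-1 < Num.min d ((hi - lo) / 2).
  near: n; have m0 : 0 < Num.min d ((hi - lo) / 2).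
    by rewrite lt_min d0 divr_gt0// subr_gt0.
  exact: (near_infty_natSinv_lt (PosNum m0)).
move: nd; rewrite lt_min => /andP[h1 h2].
rewrite /F; move: n0 h1 h2; set h := _^-1 => n0 h1 h2.
by apply: Hd; [apply/andP; split; lra|apply/andP; split; lra|lra].
Unshelve. all: by end_near. Qed.

Variables (a b : R) (g w : R -> R).
Hypothesis gc : continuous g.
Hypothesis gac : abs_cont a b g.
Hypothesis iw : mu.-integrable setT (EFin \o w).
Hypothesis gw : forall x, a <= x <= b -> g x - g a = \int[mu]_(t in `[a, x]) w t.
Hypothesis dg : {ae mu, forall x, a < x < b -> derivable g x 1 /\ derive1 g x = w x}.
Hypothesis iw2 : mu.-integrable `[a, b] (EFin \o (fun x => w x ^+ 2)).

Lemma energy_integrable_sub (b1 b2 : bool) x y : a <= x -> y <= b ->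
  mu.-integrable [set` Interval (BSide b1 x) (BSide b2 y)] (EFin \o (fun x => w x ^+ 2)).
Proof.
move=> ax yb; apply: integrableS iw2; [exact: measurable_itv..|].
by apply: subset_itv; case: b1 b2 => -[]; rewrite bnd_simp// ltW.
Qed.

Lemma energy_mono x y x' y' : a <= x' -> x' <= x -> y <= y' -> y' <= b ->
  \int[mu]_(t in `]x, y[) w t ^+ 2 <= \int[mu]_(t in `]x', y'[) w t ^+ 2.
Proof.
move=> ax' x'x yy' y'b; apply: fine_le.
- apply: integrable_fin_num; first exact: measurable_itv.
  by apply: energy_integrable_sub; [exact: le_trans x'x|exact: le_trans y'b].
- apply: integrable_fin_num; first exact: measurable_itv.
  exact: energy_integrable_sub.
- apply: ge0_subset_integral; [exact: measurable_itv..| | |].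
  + by have /integrableP[] := energy_integrable_sub false true ax' y'b.
  + by move=> t _; rewrite lee_fin sqr_ge0.
  + by apply: subset_itv; rewrite bnd_simp.
Qed.

(** [psi] may be singular at both ends, so the boundary terms only enter through
    one-sided upper bounds [A] and [B] near the ends. *)
Lemma riccati_oo (lo hi : R) (psi dpsi V : R -> R) (K A B : R) :
  a <= lo -> lo < hi -> hi <= b -> 0 < K ->
  (forall x, lo < x < hi -> is_derive x 1 psi (dpsi x)) ->
  (forall x, lo < x < hi -> {for x, continuous dpsi}) ->
  measurable_fun `]lo, hi[ V ->
  (forall x, lo < x < hi -> 0 <= V x) ->
  (forall x, lo < x < hi -> V x + K * (dpsi x + psi x ^+ 2) <= 0) ->
  (forall eta, 0 < eta -> exists2 d, 0 < d & forall c, lo < c < lo + d ->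
    K * (psi c * g c ^+ 2) <= A + eta) ->
  (forall eta, 0 < eta -> exists2 d, 0 < d & forall e, hi - d < e < hi ->
    - (K * (psi e * g e ^+ 2)) <= B + eta) ->
  (\int[mu]_(x in `]lo, hi[) (V x * g x ^+ 2)%:E <=
   (K * \int[mu]_(x in `]lo, hi[) w x ^+ 2 + A + B)%:E)%E.
Proof.
move=> alo lohi hib K0 Dpsi Cpsi mV V0 HV HA HB.
apply: integral_oo_le => //.
- apply/measurable_EFinP; apply: measurable_funM => //.
  have mg : measurable_fun setT g by exact: continuous_measurable_fun.
  exact/measurable_funX/measurable_funTS.
- by move=> x xlh; rewrite lee_fin mulr_ge0 ?V0 ?sqr_ge0.
move=> eta eta0; have e2 : 0 < eta / 2 by rewrite divr_gt0.
have [d d0 Hd] := HA _ e2; have [d' d'0 Hd'] := HB _ e2.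
exists (Num.min d d'); first by rewrite lt_min d0.
move=> c e /andP[loc clod] /andP[hide ehi] ce.
have cd : c < lo + d by rewrite (lt_le_trans clod)// lerD2l ge_min lexx.
have ed' : hi - d' < e by rewrite (le_lt_trans _ hide)// lerD2l lerN2 ge_min lexx orbT.
have inn x : c <= x <= e -> lo < x < hi.
  by move=> /andP[cx xe]; rewrite (lt_le_trans loc cx) (le_lt_trans xe ehi).
have inno x : c < x < e -> lo < x < hi.
  by move=> /andP[cx xe]; apply: inn; rewrite !ltW.
have ac : a <= c by rewrite (le_trans alo)// ltW.
have eb : e <= b by rewrite (le_trans (ltW ehi)).
have iw2oo : mu.-integrable `]a, b[ (EFin \o (fun x => w x ^+ 2)) by exact: energy_integrable_sub.
apply: le_trans (riccati_segment gc gac iw dg iw2oo ac ce eb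
  (fun x h => Dpsi x (inn x h)) (fun x h => Cpsi x (inn x h)) K0 _
  (fun x h => V0 x (inno x h)) (fun x h => HV x (inno x h))) _.
  apply: measurable_funS mV; first exact: measurable_itv.
  by move=> x; rewrite /= !in_itv/=; exact: inno.
rewrite lee_fin.
have h1 := Hd c (introT andP (conj loc cd)).
have h2 := Hd' e (introT andP (conj ed' ehi)).
have h3 := energy_mono alo (ltW loc) (ltW ehi) hib.
have : K * \int[mu]_(x in `]c, e[) w x ^+ 2 <= K * \int[mu]_(x in `]lo, hi[) w x ^+ 2.
  by rewrite ler_wpM2l// ltW.
lra.
Qed.

(** Cauchy-Schwarz, from [int (w - t)^2 >= 0] with [t] the mean of [w]. *)
Lemma increment_sqr_le x y : a <= x -> x < y -> y <= b ->
  (g y - g x) ^+ 2 <= (y - x) * \int[mu]_(t in `]x, y[) w t ^+ 2.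
Proof.
move=> ax xy yb.
have iwI : mu.-integrable `]x, y[ (EFin \o w) by exact: integrableS iw.
have gxy : g y - g x = \int[mu]_(t in `]x, y[) w t.
  have -> : g y - g x = (g y - g a) - (g x - g a) by ring.
  rewrite !gw ?ax ?(ltW (lt_le_trans xy yb)) ?(le_trans ax (ltW xy))//.
  rewrite Rintegral_itvB ?bnd_simp ?(ltW xy)//; last exact: integrableS iw.
  by rewrite Rintegral_itv_bndo_bndc.
have iw2I := energy_integrable_sub false true ax yb.
have mI : measurable (`]x, y[ : set (measurableTypeR R)) by exact: measurable_itv.
pose t := (g y - g x) / (y - x).
have : 0 <= \int[mu]_(z in `]x, y[) (w z ^+ 2 - (2 * t) * w z + t ^+ 2).
  by apply: Rintegral_ge0 => z _; have := sqr_ge0 (w z - t); lra.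
have ic (k : R) : mu.-integrable `]x, y[ (EFin \o (fun=> k)).
  have icc : mu.-integrable `[x, y] (EFin \o (fun=> k)).
    apply: continuous_compact_integrable; first exact: segment_compact.
    by apply: continuous_subspaceT => z; exact: cst_continuous.
  apply: integrableS icc => //.
  by apply: subset_itv; rewrite bnd_simp.
have itw : mu.-integrable `]x, y[ (EFin \o (fun z => 2 * t * w z)).
  by have := integrableZl mI (2 * t) iwI; exact: eq_integrable.
rewrite RintegralD//; last first.
  by have := integrableB mI iw2I itw; exact: eq_integrable.
rewrite RintegralB// RintegralZl// Rintegral_cst//.
have -> : fine (mu `]x, y[) = y - x by rewrite lebesgue_measure_itv/= lte_fin xy.
rewrite -gxy => h.
have yx : 0 < y - x by rewrite subr_gt0.
rewrite mulrC -ler_pdivrMr//; move: h.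
have -> : g y - g x = t * (y - x) by rewrite /t mulfVK// gt_eqF.
have -> : (t * (y - x)) ^+ 2 / (y - x) = t ^+ 2 * (y - x) by field; rewrite gt_eqF.
lra.
Qed.

End exhaustion.

(** * Boundary terms on the two halves *)

Section two_sided.
Context {R : realType}.
Notation mu := (@lebesgue_measure R).

Lemma is_derive_shift (f : R -> R) (c x df : R) :
  is_derive (x - c) 1 f df -> is_derive x 1 (fun y => f (y - c)) df.
Proof.
move=> Df; have Dg : is_derive x 1 (fun y : R => y - c) 1.
  by rewrite -[X in is_derive _ _ _ X]subr0; apply: is_deriveB.
by have := @is_derive1_comp _ f (fun y => y - c) x _ _ Df Dg; rewrite mulr1.
Qed.

Lemma is_derive_reflect (f : R -> R) (c x df : R) :
  is_derive (c - x) 1 f df -> is_derive x 1 (fun y => - f (c - y)) df.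
Proof.
move=> Df; have Dg : is_derive x 1 (fun y : R => c - y) (-1).
  by rewrite -[X in is_derive _ _ _ X]sub0r; apply: is_deriveB.
have := @is_derive1_comp _ f (fun y => c - y) x _ _ Df Dg; rewrite mulrN1 => /is_deriveN.
by rewrite opprK.
Qed.

Lemma continuous_lower (f : R -> R) x0 : {for x0, continuous f} ->
  forall eta, 0 < eta -> exists2 d, 0 < d &
    forall x, `|x0 - x| < d -> - f x <= - f x0 + eta.
Proof.
move=> /cvgrPdist_le cf eta eta0; have [d/= d0 Hd] := cf _ eta0.
exists d => // x xd; have := Hd x xd; rewrite ler_norml => /andP[_]; lra.
Qed.

Variables (a b : R) (g w : R -> R).
Hypothesis ab : a < b.
Hypothesis gc : continuous g.
Hypothesis gac : abs_cont a b g.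
Hypothesis iw : mu.-integrable setT (EFin \o w).
Hypothesis gw : forall x, a <= x <= b -> g x - g a = \int[mu]_(t in `[a, x]) w t.
Hypothesis dg : {ae mu, forall x, a < x < b -> derivable g x 1 /\ derive1 g x = w x}.
Hypothesis iw2 : mu.-integrable `[a, b] (EFin \o (fun x => w x ^+ 2)).
Hypotheses (ga : g a = 0) (gb : g b = 0).

Let I x y := \int[mu]_(t in `]x, y[) w t ^+ 2.

Let I_ge0 x y : 0 <= I x y.
Proof. by apply: Rintegral_ge0 => t _; exact: sqr_ge0. Qed.

Let I_cc x y : a <= x -> y <= b -> I x y = \int[mu]_(t in `[x, y]) w t ^+ 2.
Proof.
move=> ax yb; rewrite /I Rintegral_itv_bndo_bndc; last exact: (energy_integrable_sub iw2).
by rewrite Rintegral_itv_obnd_cbnd//; exact: (energy_integrable_sub iw2).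
Qed.

Lemma energy_near_a eta : 0 < eta ->
  exists2 r, 0 < r & forall c, a < c < a + r -> c < b -> I a c <= eta.
Proof.
move=> eta0; have /cvgrPdist_le/(_ _ eta0)[r/= r0 Hr] := parameterized_integral_cvg_left ab iw2.
exists r => // c /andP[ac car] cb.
have := Hr c; rewrite sub0r normrN /parameterized_integral -I_cc ?(ltW cb)//.
rewrite ger0_norm//; apply.
by rewrite /ball_/= distrC ger0_norm ?subr_ge0 ?(ltW ac)//; lra.
Qed.

Lemma energy_near_b eta : 0 < eta ->
  exists2 r, 0 < r & forall c, b - r < c < b -> a < c -> I c b <= eta.
Proof.
move=> eta0; have /cvgrPdist_le/(_ _ eta0)[r/= r0 Hr] := parameterized_integral_cvg_at_left ab iw2.
exists r => // c /andP[bc cb] ac.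
have bcr : ball_ Num.norm b r c.
  by rewrite /ball_/= ger0_norm ?subr_ge0 ?(ltW cb)//; lra.
have := Hr c bcr cb; rewrite /parameterized_integral Rintegral_itvB ?bnd_simp ?(ltW cb) ?(ltW ac)//.
rewrite -Rintegral_itv_bndo_bndc; last by apply: (energy_integrable_sub iw2) => //; exact: ltW.
by rewrite ger0_norm; last exact: I_ge0.
Qed.

Variables (eta deta U : R -> R) (K M : R).
Let d := (b - a) / 2.
Hypothesis K0 : 0 < K.
Hypothesis M0 : 0 <= M.
Hypothesis Deta : forall s, 0 < s <= d -> is_derive s 1 eta (deta s).
Hypothesis Ceta : forall s, 0 < s <= d -> {for s, continuous deta}.
Hypothesis eta_le : forall s, 0 < s <= d -> s * eta s <= M.
Hypothesis mU : measurable_fun setT U.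
Hypothesis U0 : forall s, 0 < s <= d -> 0 <= U s.
Hypothesis HU : forall s, 0 < s <= d -> U s + K * (deta s + eta s ^+ 2) <= 0.

Let d0 : 0 < d. Proof. by rewrite /d divr_gt0// subr_gt0. Qed.
Let mid := a + d.
Let midE : mid = b - d. Proof. by rewrite /mid /d; field. Qed.

(** [eta s * h^2 <= (s eta s) * J <= M J]; the bound [M] is one-sided, which is
    enough because the term is harmless when [eta s <= 0]. *)
Let boundary_small s h J e : 0 < s <= d -> 0 < e -> 0 <= J -> h ^+ 2 <= s * J -> J <= e / (K * (M + 1)) ->
  K * (eta s * h ^+ 2) <= e.
Proof.
move=> sd e0 J0 hJ Je; have s0 : 0 < s by case/andP: sd.
have KM : 0 < K * (M + 1) by rewrite mulr_gt0// ltr_wpDl.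
have [e_le0|e_gt0] := leP (eta s) 0.
  by rewrite (le_trans _ (ltW e0))// mulr_ge0_le0 ?(ltW K0)// mulr_le0_ge0// sqr_ge0.
apply: (@le_trans _ _ (K * (M * J))).
  rewrite ler_wpM2l ?(ltW K0)// (@le_trans _ _ (eta s * (s * J)))//.
    by rewrite ler_wpM2l// ltW.
  by rewrite mulrA ler_wpM2r// mulrC eta_le.
move: Je; rewrite ler_pdivlMr//; have := mulr_ge0 (ltW K0) J0; nra.
Qed.

Lemma hardy_left :
  (\int[mu]_(x in `]a, mid[) (U (x - a) * g x ^+ 2)%:E <=
   (K * I a mid + 0 + - (K * (eta d * g mid ^+ 2)))%:E)%E.
Proof.
have am : a < mid by rewrite ltrDl.
have mb : mid <= b by rewrite midE gerBl ltW.
have ins x : a < x < mid -> 0 < x - a <= d.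
  by rewrite /mid => /andP[? ?]; apply/andP; split; lra.
apply: (@riccati_oo _ a b g w gc gac iw dg iw2 a mid (fun x => eta (x - a))
  (fun x => deta (x - a)) (fun x => U (x - a)) K 0 _) => //.
- by move=> x /ins h; apply: is_derive_shift; exact: Deta.
- move=> x /ins h; apply: continuous_comp; last exact: Ceta.
  by apply: cvgB => //; exact: cvg_cst.
- apply: measurable_funTS; apply: measurableT_comp => //.
  exact: measurable_funB.
- by move=> x /ins; exact: U0.
- by move=> x /ins; exact: HU.
- move=> e e0; have KM : 0 < e / (K * (M + 1)) by rewrite divr_gt0// mulr_gt0// ltr_wpDl.
  have [r r0 Hr] := energy_near_a KM.
  exists (Num.min r d); first by rewrite lt_min r0.
  move=> c /andP[ac]; rewrite -ltrBlDl lt_min => /andP[cr cd].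
  have cmid : c < mid by rewrite /mid; lra.
  rewrite add0r; apply: (boundary_small (J := I a c)) => //.
  + by rewrite subr_gt0 ac ltW.
  + have := increment_sqr_le iw gw iw2 (lexx a) ac (ltW (lt_le_trans cmid mb)).
    by rewrite ga subr0.
  + by apply: Hr; [rewrite ac -ltrBlDl|exact: lt_le_trans mb].
- move=> e e0; pose f x := K * (eta (x - a) * g x ^+ 2).
  have ma : mid - a = d by rewrite /mid; ring.
  have -> : K * (eta d * g mid ^+ 2) = f mid by rewrite /f ma.
  have [|r r0 Hr] := @continuous_lower f mid _ e e0.
    apply: cvgM; first exact: cvg_cst.
    apply: cvgM; last by apply: cvgM; exact: gc.
    have : is_derive mid 1 (fun x => eta (x - a)) (deta d).
      apply: is_derive_shift; rewrite ma.
      by apply: Deta; rewrite d0 lexx.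
    by move=> -[/derivable1_diffP/differentiable_continuous].
  exists r => // x /andP[mx xm]; apply: Hr.
  by rewrite ger0_norm ?subr_ge0 ?(ltW xm)//; lra.
Qed.

(** The mirror image of the left half: [psi x = - eta (b - x)] solves the same
    Riccati inequality. *)
Lemma hardy_right :
  (\int[mu]_(x in `]mid, b[) (U (b - x) * g x ^+ 2)%:E <=
   (K * I mid b + - (K * (eta d * g mid ^+ 2)) + 0)%:E)%E.
Proof.
have am : a <= mid by rewrite lerDl ltW.
have mb : mid < b by rewrite midE gtrBl.
have ins x : mid < x < b -> 0 < b - x <= d.
  by rewrite midE => /andP[? ?]; apply/andP; split; lra.
apply: (@riccati_oo _ a b g w gc gac iw dg iw2 mid b (fun x => - eta (b - x))
  (fun x => deta (b - x)) (fun x => U (b - x)) K _ 0) => //.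
- by move=> x /ins h; apply: is_derive_reflect; exact: Deta.
- move=> x /ins h; apply: (@continuous_comp _ _ _ (fun x => b - x) deta); last exact: Ceta.
  by apply: cvgB => //; exact: cvg_cst.
- apply: measurable_funTS; apply: measurableT_comp => //.
  exact: measurable_funB.
- by move=> x /ins; exact: U0.
- by move=> x /ins; rewrite sqrrN; exact: HU.
- move=> e e0; pose f x := K * (eta (b - x) * g x ^+ 2).
  have bm : b - mid = d by rewrite midE; ring.
  have -> : K * (eta d * g mid ^+ 2) = f mid by rewrite /f bm.
  have [|r r0 Hr] := @continuous_lower f mid _ e e0.
    apply: cvgM; first exact: cvg_cst.
    apply: cvgM; last by apply: cvgM; exact: gc.
    apply: (@continuous_comp _ _ _ (fun x => b - x) eta).
      by apply: cvgB => //; exact: cvg_cst.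
    have [|+ _] := Deta (s := b - mid); first by rewrite bm d0 lexx.
    by move=> /derivable1_diffP/differentiable_continuous.
  exists r => // x /andP[mx xm]; rewrite mulNr mulrN; apply: Hr.
  by rewrite ler0_norm ?subr_le0 ?(ltW mx)//; lra.
- move=> e e0; have KM : 0 < e / (K * (M + 1)) by rewrite divr_gt0// mulr_gt0// ltr_wpDl.
  have [r r0 Hr] := energy_near_b KM.
  exists (Num.min r d); first by rewrite lt_min r0.
  move=> c /andP[+ cb]; rewrite ltrBlDr -ltrBlDl lt_min => /andP[cr cd].
  have cmid : mid < c by rewrite midE; lra.
  rewrite add0r mulNr mulrN opprK; apply: (boundary_small (J := I c b)) => //.
  + by rewrite subr_gt0 cb ltW.
  + have := increment_sqr_le iw gw iw2 (le_trans am (ltW cmid)) cb (lexx b).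
    by rewrite gb sub0r sqrrN.
  + by apply: Hr; [rewrite cb andbT; lra|exact: le_lt_trans cmid].
Qed.

End two_sided.

(** * Weighted inequalities from a profile *)

Section profile.
Context {R : realType}.
Notation mu := (@lebesgue_measure R).

(** The integral of a nonnegative function is a supremum over the simple functions
    below it, hence monotone without measurability. *)
Lemma le_integral_nonmeasurable (D : set R) (f h : R -> \bar R) :
  (forall x, D x -> (0 <= f x)%E) -> (forall x, D x -> (f x <= h x)%E) ->
  (\int[mu]_(x in D) f x <= \int[mu]_(x in D) h x)%E.
Proof.
move=> f0 fh; rewrite integral_mkcond [leRHS]integral_mkcond.
rewrite !ge0_integralTE; last 2 first.
- by move=> x; apply: erestrict_ge0 => y Dy; rewrite (le_trans _ (fh _ Dy)) ?f0.
- by move=> x; apply: erestrict_ge0 => y Dy; exact: f0.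
apply: le_ereal_sup => _ [k kf <-]; exists k => // x.
by rewrite (le_trans (kf x))// !patchE; case: ifPn => // /set_mem; exact: fh.
Qed.

(** [derive1 g] equals [w] off a null set [N], but takes arbitrary values on [N] and
    is not known to be measurable; comparing it from below with [w^2] cut off on
    [N] avoids both problems. *)
Lemma energy_le_derive (a b : R) (g w : R -> R) : measurable_fun setT w ->
  {ae mu, forall x, a < x < b -> derivable g x 1 /\ derive1 g x = w x} ->
  (\int[mu]_(x in `[a, b]) (w x ^+ 2)%:E <=
   \int[mu]_(x in `[a, b]) (`|derive1 g x| ^+ 2)%:E)%E.
Proof.
move=> mw [N [mN N0 Nsub]].
pose A : set (measurableTypeR R) := `]a, b[%classic `\` N.
have mA : measurable A by apply: measurableD => //; exact: measurable_itv.
have mI : measurable (`[a, b] : set (measurableTypeR R)) by exact: measurable_itv.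
pose f x := (w x ^+ 2 * \1_A x)%:E.
have mw2 : measurable_fun `[a, b] (fun x => (w x ^+ 2)%:E).
  by apply/measurable_EFinP; apply: measurable_funX; exact: measurable_funTS.
have -> : (\int[mu]_(x in `[a, b]) (w x ^+ 2)%:E = \int[mu]_(x in `[a, b]) f x)%E.
  apply: ae_eq_integral => //.
    apply/measurable_EFinP; apply: measurable_funM.
      by apply: measurable_funX; exact: measurable_funTS.
    exact: measurable_funTS.
  exists (N `|` ([set a] `|` [set b])); split.
  - by apply: measurableU => //; apply: measurableU; exact: measurable_set1.
  - apply/eqP; rewrite -measure_le0.
    have mab : measurable ([set a] `|` [set b] : set (measurableTypeR R)).
      by apply: measurableU; exact: measurable_set1.
    apply: le_trans (measureU2 _ mN mab) _; rewrite [X in (X + _)%E]N0 add0e.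
    apply: le_trans (measureU2 _ _ _) _; [exact: measurable_set1..|].
    by rewrite [X in (X + _)%E]lebesgue_measure_set1 add0e [X in (X <= _)%E]lebesgue_measure_set1.
  - move=> x /= h; apply: contrapT => /not_orP[nN /not_orP[xa xb]]; apply: h => xab.
    rewrite /f indicE mem_set ?mulr1//; split => //=; move: xab; rewrite !in_itv/= !lt_neqAle.
    by move=> /andP[-> ->]; rewrite !andbT; apply/andP; split; apply/eqP => // /esym.
apply: le_integral_nonmeasurable => x xab.
  by rewrite lee_fin mulr_ge0 ?sqr_ge0.
rewrite lee_fin indicE; case: (boolP (x \in A)); last first.
  by rewrite mulr0 exprn_ge0.
move=> /set_mem[/=]; rewrite in_itv/= => xoo xN; rewrite mulr1.
suff [_ ->] : derivable g x 1 /\ derive1 g x = w x by rewrite real_normK ?num_real.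
by apply: contrapT => h; apply: xN; apply: Nsub => /= h'; apply: h; exact: h'.
Qed.

Lemma ge0_integral_split (a m b : R) (f : R -> \bar R) : a < m -> m < b ->
  measurable_fun setT f -> (forall x, a <= x <= b -> (0 <= f x)%E) ->
  (\int[mu]_(x in `[a, b]) f x =
   \int[mu]_(x in `]a, m[) f x + \int[mu]_(x in `]m, b[) f x)%E.
Proof.
move=> am mb mf f0.
rewrite integral_itv_bndoo; last exact: measurable_funTS.
rewrite (@itv_bndbnd_setU _ _ (BRight a) (BRight m) (BLeft b)); last 2 first.
- by rewrite bnd_simp ltW.
- by rewrite bnd_simp.
rewrite ge0_integral_setU//=.
- by rewrite [in X in (X + _)%E]integral_itv_bndoo//; exact: measurable_funTS.
- exact: measurable_funTS.
- by move=> x [] /=; rewrite in_itv/= => /andP[h1 h2]; apply: f0;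
    [rewrite (ltW h1) (le_trans h2)// ltW|rewrite (ltW h2) (le_trans _ (ltW h1))// ltW].
- apply/disj_setPS => x [/=]; rewrite !in_itv/= => /andP[_ xm] /andP[].
  by rewrite ltNge xm.
Qed.

(** [L] measures how negative the profile is at the midpoint: there
    [- K eta(d) g^2 <= K L g^2 / d], which is at most [K L] times the energy of
    either half. If the energy is infinite there is nothing to prove, and otherwise
    [g] is first extended by constants to a continuous function on the line. *)
Lemma hardy_of_profile (a b : R) (g : R -> R) (eta deta U : R -> R) (K M L : R) :
  a < b -> abs_cont a b g -> g a = 0 -> g b = 0 ->
  let d := (b - a) / 2 in
  0 < K -> 0 <= M -> 0 <= L ->
  (forall s, 0 < s <= d -> is_derive s 1 eta (deta s)) ->
  (forall s, 0 < s <= d -> {for s, continuous deta}) ->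
  (forall s, 0 < s <= d -> s * eta s <= M) ->
  0 <= L + d * eta d ->
  measurable_fun setT U ->
  (forall s, 0 < s <= d -> 0 <= U s) ->
  (forall s, 0 < s <= d -> U s + K * (deta s + eta s ^+ 2) <= 0) ->
  (\int[mu]_(x in `[a, b]) (U (bdist a b x) * g x ^+ 2)%:E <=
   (K * (1 + L))%:E * \int[mu]_(x in `[a, b]) (`|derive1 g x| ^+ 2)%:E)%E.
Proof.
move=> ab gac ga gb d K0 M0 L0 Deta Ceta eta_le eta_d mU U0 HU.
have [w [iw gw dg]] := abs_cont_density ab gac.
have mw : measurable_fun setT w by apply/measurable_EFinP; exact: measurable_int iw.
have KL : 0 < K * (1 + L) by rewrite mulr_gt0// ltr_wpDr.
have := energy_le_derive mw dg.
set E := (X in (_ <= X)%E) => wE.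
suff main : (\int[mu]_(x in `[a, b]) (U (bdist a b x) * g x ^+ 2)%:E <=
   (K * (1 + L))%:E * \int[mu]_(x in `[a, b]) (w x ^+ 2)%:E)%E.
  by rewrite (le_trans main)// lee_pmul2l// lte_fin.
have [woo|] := leP +oo%E (\int[mu]_(x in `[a, b]) (w x ^+ 2)%:E)%E.
  move: woo; rewrite leye_eq => /eqP ->.
  by rewrite gt0_muley ?lte_fin// leey.
move=> woo.
have iw2 : mu.-integrable `[a, b] (EFin \o (fun x => w x ^+ 2)).
  apply/integrableP; split.
    by apply/measurable_EFinP; apply: measurable_funX; exact: measurable_funTS.
  by under eq_integral do rewrite /= ger0_norm ?sqr_ge0//.
pose h := g \o clamp a b.
have hg x : a <= x <= b -> h x = g x by move=> xab; rewrite /h /= clamp_id.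
have hac : abs_cont a b h.
  move=> e e0; have [r r0 Hr] := gac e e0; exists r => // n x y Hxy tr ls.
  have := Hr n x y Hxy tr ls; congr (_ < _); apply: eq_bigr => i _.
  have [h1 h2 h3] := Hxy i.
  by rewrite !hg ?h1 ?h3 ?(le_trans (ltW h2) h3) ?(le_trans h1 (ltW h2)).
have hc : continuous h by exact: abs_cont_continuous (abs_cont_clamp (ltW ab) gac).
have ha : h a = 0 by rewrite hg ?lexx ?(ltW ab).
have hb : h b = 0 by rewrite hg ?lexx ?(ltW ab).
have hw x : a <= x <= b -> h x - h a = \int[mu]_(t in `[a, x]) w t.
  by move=> xab; rewrite hg// ha -ga gw.
have dh : {ae mu, forall x, a < x < b -> derivable h x 1 /\ derive1 h x = w x}.
  move: dg; apply: filterS; first exact: (ae_filter_ringOfSetsType mu).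
  move=> x dgx xab; have [d1 d2] := dgx xab.
  have gh : \forall y \near x, g y = h y.
    have [ax xb] := andP xab.
    near=> y; rewrite hg//; apply/andP; split; apply/ltW; near: y.
      exact: lt_nbhsr.
    exact: lt_nbhsl.
  have Dh : is_derive x 1 h (w x).
    by apply: near_eq_is_derive gh _; apply: DeriveDef => //; rewrite -derive1E.
  by split; [case: Dh|rewrite derive1E; case: Dh].
have d0 : 0 < d by rewrite divr_gt0// subr_gt0.
pose mid := a + d.
have midE : mid = b - d by rewrite /mid /d; field.
have am : a < mid by rewrite ltrDl.
have mb : mid < b by rewrite midE gtrBl.
have left := hardy_left ab hc hac iw hw dh iw2 ha K0 M0 Deta Ceta eta_le mU U0 HU.
have right := hardy_right ab hc hac iw hw dh iw2 hb K0 M0 Deta Ceta eta_le mU U0 HU.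
have eL := increment_sqr_le iw hw iw2 (lexx a) am (ltW mb).
have eR := increment_sqr_le iw hw iw2 (ltW am) mb (lexx b).
move: left right eL eR; rewrite -/d -/mid ha hb subr0 sub0r sqrrN.
have -> : mid - a = d by rewrite /mid; ring.
have -> : b - mid = d by rewrite midE; ring.
set J1 := Rintegral mu `]a, mid[ _; set J2 := Rintegral mu `]mid, b[ _.
move=> left right eL eR.
have Usplit : (\int[mu]_(x in `[a, b]) (U (bdist a b x) * g x ^+ 2)%:E =
  \int[mu]_(x in `]a, mid[) (U (x - a) * h x ^+ 2)%:E +
  \int[mu]_(x in `]mid, b[) (U (b - x) * h x ^+ 2)%:E)%E.
  transitivity (\int[mu]_(x in `[a, b]) (U (bdist a b x) * h x ^+ 2)%:E)%E.
    by apply: eq_integral => x /set_mem/=; rewrite in_itv/= => xab; rewrite hg.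
  have mdist : measurable_fun setT (bdist a b).
    by apply: measurable_minr; exact: measurable_funB.
  rewrite (ge0_integral_split am mb).
  - congr (_ + _)%E; apply: eq_integral => x /set_mem/=; rewrite in_itv/= => /andP[h1 h2];
      rewrite /bdist; [rewrite min_r//|rewrite min_l//]; move: h1 h2 am mb; rewrite /mid /d; lra.
  - apply/measurable_EFinP; apply: measurable_funM; first exact: measurableT_comp.
    by apply: measurable_funX; exact: continuous_measurable_fun.
  - move=> x /andP[ax xb]; rewrite lee_fin; have [x0|x0] := ltP 0 (bdist a b x).
      rewrite mulr_ge0 ?sqr_ge0// U0// x0/= /bdist ge_min.
      by case: (leP (b - x) d) => //= h1; move: h1; rewrite /d; lra.
    suff -> : h x = 0 by rewrite expr0n mulr0.
    move: x0; rewrite /bdist ge_min !subr_le0 => /orP[bx|xa].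
      by have -> : x = b by apply/eqP; rewrite eq_le xb.
    by have -> : x = a by apply/eqP; rewrite eq_le xa.
have Jsplit : (\int[mu]_(x in `[a, b]) (w x ^+ 2)%:E = (J1 + J2)%:E)%E.
  rewrite (ge0_integral_split am mb).
  - rewrite EFinD /J1 /J2 /Rintegral !fineK//.
      by apply: integrable_fin_num; [exact: measurable_itv|exact: (energy_integrable_sub iw2 _ _ (ltW am) (lexx b))].
    by apply: integrable_fin_num; [exact: measurable_itv|exact: (energy_integrable_sub iw2 _ _ (lexx a) (ltW mb))].
  - by apply/measurable_EFinP; exact: measurable_funX.
  - by move=> x _; rewrite lee_fin sqr_ge0.
have bnd J : 0 <= J -> h mid ^+ 2 <= d * J -> - (K * (eta d * h mid ^+ 2)) <= K * L * J.
  move=> J0 hJ; rewrite -mulrN -mulrA ler_wpM2l ?(ltW K0)// -mulNr.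
  have [e0|e0] := leP 0 (eta d).
    by rewrite (@le_trans _ _ 0)// ?mulr_ge0// mulr_le0_ge0 ?oppr_le0 ?sqr_ge0.
  apply: (@le_trans _ _ (- eta d * (d * J))).
    by rewrite ler_wpM2l// oppr_ge0 ltW.
  by rewrite mulrA ler_wpM2r//; move: eta_d; lra.
have J10 : 0 <= J1 by apply: Rintegral_ge0 => x _; exact: sqr_ge0.
have J20 : 0 <= J2 by apply: Rintegral_ge0 => x _; exact: sqr_ge0.
have H := bnd _ J10 eL; have H' := bnd _ J20 eR.
rewrite Usplit Jsplit -EFinM; apply: le_trans (leeD left right) _.
rewrite -EFinD lee_fin addr0.
have -> : K * (1 + L) * (J1 + J2) = K * J1 + K * J2 + (K * L * J1 + K * L * J2) by ring.
lra.
Unshelve. all: by end_near. Qed.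

End profile.

(** * A power series and its differential equation *)

Section power_series.
Context {R : realType}.
Implicit Types (c : R^nat) (x : R).

(** Coefficients dominated by those of the exponential series: this makes the sum
    entire and passes to the derived series. *)
Definition exp_bounded c := forall k, `|c k| <= k`!%:R^-1.

Lemma exp_bounded_diffs c : exp_bounded c -> exp_bounded (pseries_diffs c).
Proof.
move=> hc k; rewrite /pseries_diffs normrM ger0_norm//.
rewrite (le_trans (ler_wpM2l _ (hc k.+1)))//.
by rewrite factS natrM invfM mulVKf.
Qed.

Lemma exp_bounded_cvg c x : exp_bounded c -> cvgn (pseries c x).
Proof.
move=> hc; apply: normed_cvg; apply: (@series_le_cvg _ _ (exp_coeff `|x|)).
- by move=> n; exact: normr_ge0.
- by move=> n; exact: exp_coeff_ge0.
- move=> n; rewrite /exp_coeff/= normrM normrX [leRHS]mulrC.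
  by rewrite ler_wpM2r// exprn_ge0.
- exact: is_cvg_series_exp_coeff.
Qed.

Definition psum c x := limn (pseries c x).

Lemma is_derive_psum c x : exp_bounded c ->
  is_derive x 1 (psum c) (psum (pseries_diffs c) x).
Proof.
move=> hc; apply: (@pseries_snd_diffs _ c (`|x| + 1)).
- exact: exp_bounded_cvg.
- exact/exp_bounded_cvg/exp_bounded_diffs.
- exact/exp_bounded_cvg/exp_bounded_diffs/exp_bounded_diffs.
- by rewrite (ger0_norm (x := `|x| + 1)) ?ltrDl// addr_ge0.
Qed.

Lemma continuous_psum c : exp_bounded c -> continuous (psum c).
Proof.
move=> hc x; have [+ _] := is_derive_psum x hc.
by move=> /derivable1_diffP/differentiable_continuous.
Qed.

Lemma psum0 c : psum c 0 = c 0%N.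
Proof.
apply/cvg_lim => //; rewrite -cvg_shiftS.
apply: cvg_near_cst; apply: nearW => n.
rewrite /pseries /series/= big_nat_recl//= expr0 mulr1 big1 ?addr0// => i _.
by rewrite exprS mul0r mulr0.
Qed.

(** The recurrence on the coefficients that is equivalent to
    [t u'' + m u' + u = 0]. *)
Definition hyp_rec (m : R) c := forall k, (k%:R + m) * k.+1%:R * c k.+1 = - c k.

(** The derivative of the differential equation is the same equation with [m + 1]
    in the place of [m]. *)
Lemma hyp_rec_diffs m c : hyp_rec m c -> hyp_rec (m + 1) (pseries_diffs c).
Proof.
move=> hc k; rewrite /pseries_diffs.
rewrite -mulrN -hc -!natr1; ring.
Qed.

Lemma psum_ode m c x : exp_bounded c -> hyp_rec m c ->
  x * psum (pseries_diffs (pseries_diffs c)) x + m * psum (pseries_diffs c) x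
    + psum c x = 0.
Proof.
move=> bc hc; have bd := exp_bounded_diffs bc.
have h2 := pseries_diffs_equiv (@exp_bounded_cvg _ x (exp_bounded_diffs bd)).
have h1 := @exp_bounded_cvg _ x bd.
have h0 := @exp_bounded_cvg _ x bc.
set l := (X in X = 0); pose v n : R :=
  x * series (fun i => i%:R * pseries_diffs c i * x ^+ i.-1) n
  + m * pseries (pseries_diffs c) x n + pseries c x n.
have cv : v @ \oo --> l.
  by apply: cvgD => //; apply: cvgD; apply: cvgM => //; exact: cvg_cst.
suff v0 : v = cst 0 by rewrite -(cvg_lim _ cv)// v0 lim_cst.
apply/funext => n; rewrite /v /pseries /series/= !mulr_sumr -!big_split/=.
apply: big1 => k _; have := hc k.
case: k => [|k] h; rewrite /pseries_diffs.
  by rewrite -[c 0%N]opprK -h /=; ring.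
by rewrite -[c k.+1]opprK -h /= exprS; ring.
Qed.

(** [(t^m v)' = t^(m - 1) (t v' + m v) <= 0], and [t^m v] tends to [0] at [0]. *)
Lemma le0_of_ode (m T : R) (v dv : R -> R) : 1 <= m -> continuous v ->
  (forall t, 0 < t <= T -> is_derive t 1 v (dv t)) ->
  (forall t, 0 < t <= T -> t * dv t + m * v t <= 0) -> 0 < T -> v T <= 0.
Proof.
move=> m1 cv Dv ode T0; have m0 : 0 < m by lra.
pose p t := t `^ m * v t.
have Dp t : 0 < t <= T -> is_derive t 1 p (t `^ (m - 1) * (t * dv t + m * v t)).
  move=> /[dup] tT /andP[t0 _].
  have D1 := is_derive1_powR m t0; have D2 := Dv t tT.
  have := is_deriveM D1 D2; rewrite /GRing.scale/=.
  rewrite (_ : _ + _ = t `^ (m - 1) * (t * dv t + m * v t)) //.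
  by rewrite -(mulr_powRB1 (ltW t0) m0); ring.
have p_le e : 0 < e <= T -> p T <= p e.
  move=> /andP[e0 eT].
  have pc : {within `[e, T], continuous p}.
    apply: derivable_within_continuous => t; rewrite in_itv/= => /andP[et tT].
    by have [] := Dp t (introT andP (conj (lt_le_trans e0 et) tT)).
  have Dp' t : t \in `]e, T[%R -> is_derive t 1 p (t `^ (m - 1) * (t * dv t + m * v t)).
    by rewrite in_itv/= => /andP[et tT]; apply: Dp; rewrite (lt_trans e0 et) ltW.
  have [t] := MVT_segment eT Dp' pc.
  rewrite in_itv/= => /andP[et tT] h.
  rewrite -subr_le0 h mulr_le0_ge0 ?subr_ge0// mulr_ge0_le0 ?powR_ge0//.
  by apply: ode; rewrite (lt_le_trans e0 et).
have [B B0 HB] := @bounded_segment _ 0 T v (fun t _ => cv t).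
rewrite leNgt; apply/negP => vT.
have pT0 : 0 < p T by rewrite mulr_gt0// powR_gt0.
pose e := Num.min (Num.min 1 T) (p T / (B * 2)).
have e0 : 0 < e by rewrite /e !lt_min ltr01 T0 divr_gt0// mulr_gt0.
have [e1 eT eB] : [/\ e <= 1, e <= T & e <= p T / (B * 2)].
  by rewrite /e !ge_min !lexx !orbT.
have := p_le e; rewrite e0 eT => /(_ isT); apply/negP; rewrite -ltNge.
apply: (@le_lt_trans _ _ (e * B)).
  apply: (@le_trans _ _ (e * `|v e|)); last first.
    by rewrite ler_wpM2l ?(ltW e0)// HB// (ltW e0).
  rewrite /p (@le_trans _ _ (e `^ m * `|v e|))//.
    by rewrite ler_wpM2l ?powR_ge0// ler_norm.
  by rewrite ler_wpM2r// ge1r_powR// e0.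
move: eB; rewrite ler_pdivlMr ?mulr_gt0//; lra.
Qed.

(** The coefficients of the confluent hypergeometric limit function
    [0F1 (; m; - t)]. *)
Definition hyp_coef (m : R) : R^nat := fun k =>
  (- 1) ^+ k / (k`!%:R * \prod_(i < k) (m + i%:R)).

Lemma hyp_coef0 m : hyp_coef m 0 = 1.
Proof. by rewrite /hyp_coef big_ord0 fact0 expr0 mul1r mulr1 invr1. Qed.

Lemma hyp_prod_ge1 (m : R) k : 1 <= m -> 1 <= \prod_(i < k) (m + i%:R).
Proof.
move=> m1; elim: k => [|k ih]; first by rewrite big_ord0.
by rewrite big_ord_recr/= mulr_ege1// (le_trans m1)// lerDl.
Qed.

Lemma hyp_coef_rec m : 1 <= m -> hyp_rec m (hyp_coef m).
Proof.
move=> m1 k; rewrite /hyp_coef big_ord_recr/= factS natrM exprS.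
have := hyp_prod_ge1 k m1; set P := \prod_(_ < _) _ => P1.
have P0 : P != 0 by rewrite gt_eqF// (lt_le_trans ltr01 P1).
have F0 : k`!%:R != 0 :> R by rewrite gt_eqF// ltr0n fact_gt0.
have mk0 : m + k%:R != 0 by rewrite gt_eqF// (lt_le_trans ltr01)// (le_trans m1)// lerDl.
have k0 : k.+1%:R != 0 :> R by rewrite gt_eqF// ltr0n.
by field; rewrite P0 F0 mk0 -natr1 addrC in k0 *; rewrite k0.
Qed.

Lemma hyp_coef_bounded m : 1 <= m -> exp_bounded (hyp_coef m).
Proof.
move=> m1 k; have P1 := hyp_prod_ge1 k m1.
have P0 : 0 < \prod_(i < k) (m + i%:R) by rewrite (lt_le_trans ltr01 P1).
rewrite /hyp_coef normrM normrX normrN1 expr1n mul1r.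
have F0 : 0 < k`!%:R :> R by rewrite ltr0n fact_gt0.
rewrite normfV ger0_norm ?mulr_ge0 ?(ltW P0)//.
by rewrite lef_pV2 ?posrE ?mulr_gt0// ler_pMr.
Qed.

Definition hyp m := psum (hyp_coef m).
Definition hyp' m := psum (pseries_diffs (hyp_coef m)).
Definition hyp'' m := psum (pseries_diffs (pseries_diffs (hyp_coef m))).

Section hyp.
Variable m : R.
Hypothesis m1 : 1 <= m.
Let bc := hyp_coef_bounded m1.
Let bd := exp_bounded_diffs bc.
Let bdd := exp_bounded_diffs bd.
Let hc := hyp_coef_rec m1.

Lemma hyp0 : hyp m 0 = 1.
Proof. by rewrite /hyp psum0 hyp_coef0. Qed.

Lemma is_derive_hyp (t : R) : is_derive t 1 (hyp m) (hyp' m t).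
Proof. exact: is_derive_psum. Qed.

Lemma is_derive_hyp' (t : R) : is_derive t 1 (hyp' m) (hyp'' m t).
Proof. exact: is_derive_psum. Qed.

Lemma continuous_hyp : continuous (hyp m).
Proof. exact: continuous_psum. Qed.

Lemma continuous_hyp' : continuous (hyp' m).
Proof. exact: continuous_psum. Qed.

Lemma continuous_hyp'' : continuous (hyp'' m).
Proof. exact: continuous_psum. Qed.

Lemma hyp_ode t : t * hyp'' m t + m * hyp' m t + hyp m t = 0.
Proof. exact: psum_ode. Qed.

Variable T : R.
Hypothesis pos : forall t, 0 <= t <= T -> 0 < hyp m t.

(** [t u'' + m u' = - u <= 0]. *)
Lemma hyp'_le0 t : 0 < t <= T -> hyp' m t <= 0.
Proof.
move=> /andP[t0 tT]; apply: (@le0_of_ode m t (hyp' m) (hyp'' m)) => //.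
- exact: continuous_hyp'.
- by move=> s _; exact: is_derive_hyp'.
- move=> s /andP[s0 st]; have := hyp_ode s.
  have := @pos s; rewrite (ltW s0) (le_trans st)// => /(_ isT); lra.
Qed.

(** The differentiated equation reads [t u''' + (m + 1) u'' = - u' >= 0]. *)
Lemma hyp''_ge0 t : 0 < t <= T -> 0 <= hyp'' m t.
Proof.
move=> /andP[t0 tT].
pose h3 := psum (pseries_diffs (pseries_diffs (pseries_diffs (hyp_coef m)))).
suff : - hyp'' m t <= 0 by rewrite oppr_le0.
apply: (@le0_of_ode (m + 1) t (fun s => - hyp'' m s) (fun s => - h3 s)) => //.
- by rewrite (le_trans m1)// lerDl.
- by move=> s; apply: cvgN; exact: continuous_hyp''.
- by move=> s _; apply: is_deriveN; exact: is_derive_psum.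
- move=> s /andP[s0 st].
  have := psum_ode s bd (hyp_rec_diffs hc); rewrite -/(h3 s) -/(hyp' m s) -/(hyp'' m s).
  have := @hyp'_le0 s; rewrite s0 (le_trans st)// => /(_ isT); lra.
Qed.

Lemma hyp_le t : 0 < t <= T -> hyp m t <= - m * hyp' m t.
Proof.
move=> /[dup] tT /andP[t0 _]; have := hyp_ode t.
have := mulr_ge0 (ltW t0) (hyp''_ge0 tT); lra.
Qed.

End hyp.

End power_series.

(** * The functional equation of the Gamma integral *)

Section gamma.
Context {R : realType}.
Notation mu := (@lebesgue_measure R).

Lemma continuous_powR_within (p n : R) : 0 <= p ->
  {within `[0, n], continuous (fun t : R => t `^ p)}.
Proof.
move=> p0; apply/subspace_continuousP => x /=; rewrite in_itv/= => /andP[x0 xn].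
have [->|p_neq0] := eqVneq p 0.
  by rewrite (_ : (fun t : R => t `^ 0) = cst 1); [exact: cvg_cst|apply/funext => t; rewrite powRr0].
have {p0 p_neq0} p0 : 0 < p by rewrite lt_neqAle eq_sym p_neq0.
move: x0; rewrite le_eqVlt => /predU1P[<-|x0].
  apply/cvgrPdist_le => e e0; rewrite /from_subspace /= powR0 ?gt_eqF//.
  have /cvgrPdist_le/(_ _ e0)[r/= r0 Hr] := powR_cvg0 p0.
  exists r => //= t tr; rewrite in_itv/= => /andP[t0 _].
  move: t0; rewrite le_eqVlt => /predU1P[<-|t0]; last exact: Hr.
  by rewrite powR0 ?gt_eqF// subrr normr0 ltW.
apply: cvg_within_filter; have [+ _] := is_derive1_powR p x0.
by move=> /derivable1_diffP/differentiable_continuous.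
Qed.

(** [exp t = (exp y)^(2 s) >= y^(2 s)] with [y = t / (2 s)]. *)
Lemma powR_expRN_le (s t : R) : 0 < s -> 0 < t ->
  t `^ s * expR (- t) <= (2 * s) `^ (2 * s) * t `^ (- s).
Proof.
move=> s0 t0; have s20 : 0 < 2 * s by rewrite mulr_gt0.
pose y := t / (2 * s).
have y0 : 0 < y by rewrite divr_gt0.
have Ey : y `^ (2 * s) <= expR t.
  have -> : expR t = expR y `^ (2 * s).
    by rewrite -expRM; congr expR; rewrite /y mulfVK// gt_eqF.
  rewrite ge0_ler_powR ?nnegrE ?(ltW s20) ?(ltW y0) ?expR_ge0//.
  by apply: le_trans (expR_ge1Dx y); rewrite lerDr.
rewrite expRN ler_pdivrMr ?expR_gt0//.
apply: (@le_trans _ _ ((2 * s) `^ (2 * s) * t `^ (- s) * y `^ (2 * s))); last first.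
  by rewrite ler_wpM2l// mulr_ge0 ?powR_ge0.
rewrite mulrAC -powRM ?(ltW s20) ?(ltW y0)//.
have -> : 2 * s * y = t by rewrite /y mulrC mulfVK ?gt_eqF.
rewrite -powRD; last by rewrite (gt_eqF t0) implybT.
by rewrite (_ : _ + _ = s)//; ring.
Qed.

Lemma gamma_boundary_cvg (s : R) : 1 <= s ->
  (n.+1%:R : R) `^ s * expR (- n.+1%:R) @[n --> \oo] --> (0 : R).
Proof.
move=> s1; have s0 : 0 < s by lra.
apply: (@squeeze_cvgr _ _ _ _ (cst 0) (fun n => (2 * s) `^ (2 * s) * harmonic n)).
- near=> n; rewrite mulr_ge0 ?powR_ge0 ?expR_ge0//=.
  apply: le_trans (powR_expRN_le s0 _) _ => //.
  rewrite ler_wpM2l ?powR_ge0// powRN lef_pV2 ?posrE ?powR_gt0//.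
  by rewrite le1r_powR// ler1n.
- exact: cvg_cst.
- by rewrite -(mulr0 ((2 * s) `^ (2 * s))); apply: cvgM; [exact: cvg_cst|exact: cvg_harmonic].
Unshelve. all: by end_near. Qed.

Definition egamma (s : R) : \bar R :=
  (\int[mu]_(t in `]0%R, +oo[) (t `^ (s - 1) * expR (- t))%:E)%E.

Let mf (s : R) : measurable_fun [set: R] (fun t : R => t `^ (s - 1) * expR (- t)).
Proof.
apply: measurable_funM; first exact: measurable_powR.
by apply: measurableT_comp => //; exact: measurable_oppr.
Qed.

Lemma egamma_cvg (s : R) :
  (\int[mu]_(t in `[0%R, n.+1%:R]) (t `^ (s - 1) * expR (- t))%:E)%E @[n --> \oo]
    --> egamma s.
Proof.
rewrite /egamma integral_itv_obnd_cbnd; last first.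
  by apply/measurable_EFinP; apply: measurable_funTS; exact: mf.
rewrite itv0y_bigcup0S; apply: ge0_nondecreasing_set_cvg_integral.
- move=> m n mn; apply/subsetPset. apply: subset_itvl. by rewrite bnd_simp ler_nat ltnS.
- by move=> n; exact: measurable_itv.
- by move=> n; apply/measurable_EFinP; apply: measurable_funTS; exact: mf.
- by move=> n x _; rewrite lee_fin mulr_ge0 ?powR_ge0 ?expR_ge0.
Qed.

(** Integration by parts of [t^s] against [exp (- t)]. *)
Lemma gamma_parts (s n : R) : 1 <= s -> 0 < n ->
  (\int[mu]_(t in `[0%R, n]) (t `^ (s + 1 - 1) * expR (- t))%:E =
   (- (n `^ s * expR (- n)))%:E +
   s%:E * \int[mu]_(t in `[0%R, n]) (t `^ (s - 1) * expR (- t))%:E)%E.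
Proof.
move=> s1 n0; have s0 : 0 < s by lra.
have Dexp (x : R) : is_derive x 1 (fun t : R => - expR (- t)) (expR (- x)).
  have D := @is_derive1_comp R expR -%R x _ _ (is_derive_expR (- x)) (is_deriveNid x 1).
  have := is_deriveN D; rewrite mulrN1 opprK; exact.
have cexp : continuous (fun t : R => expR (- t)).
  by move=> x; apply: continuous_comp; [exact: oppr_continuous|exact: continuous_expR].
have cGN : continuous (fun t : R => - expR (- t)) by move=> x; apply: cvgN; exact: cexp.
have Fc : {within `[0, n], continuous (fun t : R => t `^ s)}.
  by apply: continuous_powR_within; lra.
have fc : {within `[0, n], continuous (fun t : R => s * t `^ (s - 1))}.
  have := @continuous_powR_within (s - 1) n; rewrite subr_ge0 => /(_ s1) h x.
  by apply: cvgM; [exact: cvg_cst|exact: h].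
under eq_integral do rewrite addrK.
have -> := @integration_by_parts R (fun t => t `^ s) (fun t => - expR (- t))
  (fun t => s * t `^ (s - 1)) (fun t => expR (- t)) 0 n n0 fc _ _ _ _ _.
- rewrite powR0 ?gt_eqF// mul0r subr0 mulrN; congr (_ + _)%E.
  under eq_integral do rewrite mulrN EFinN -mulrA EFinM.
  rewrite integral_ge0N ?oppeK; last first.
    by move=> t _; rewrite mule_ge0 ?lee_fin ?(ltW s0)// mulr_ge0 ?powR_ge0 ?expR_ge0.
  rewrite ge0_integralZl// ?lee_fin ?(ltW s0)//.
  + by apply/measurable_EFinP; apply: measurable_funTS; exact: mf.
  + by move=> t _; rewrite lee_fin mulr_ge0 ?powR_ge0 ?expR_ge0.
- split.
  + by move=> t; rewrite in_itv/= => /andP[t0 _]; have [] := is_derive1_powR s t0.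
  + by rewrite powR0 ?gt_eqF//; exact: powR_cvg0.
  + apply: cvg_at_left_filter; have [+ _] := is_derive1_powR s n0.
    by move=> /derivable1_diffP/differentiable_continuous.
- move=> t; rewrite in_itv/= => /andP[t0 _]; rewrite derive1E.
  by have [_ ->] := is_derive1_powR s t0.
- exact: continuous_subspaceT.
- split; first by move=> t _; have [] := Dexp t.
  + by apply: cvg_at_right_filter; exact: cGN.
  + by apply: cvg_at_left_filter; exact: cGN.
- by move=> t _; rewrite derive1E; have [_ ->] := Dexp t.
Qed.

Lemma egammaD1 (s : R) : 1 <= s -> egamma (s + 1) = (s%:E * egamma s)%E.
Proof.
move=> s1.
have h1 := @egamma_cvg (s + 1).
have h2 : ((- (n.+1%:R `^ s * expR (- n.+1%:R)))%:E + 
   s%:E * \int[mu]_(t in `[0%R, n.+1%:R]) (t `^ (s - 1) * expR (- t))%:E)%E @[n --> \oo]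
    --> (0%:E + s%:E * egamma s)%E.
  apply: cvgeD.
  - by [].
  - apply: cvg_EFin; first by apply: nearW.
    by rewrite -oppr0; apply: cvgN; exact: gamma_boundary_cvg.
  - by apply: cvgeZl => //; exact: egamma_cvg.
have e12 : (fun n => \int[mu]_(t in `[0%R, n.+1%:R]) (t `^ (s + 1 - 1) * expR (- t))%:E)%E
    = (fun n => (- (n.+1%:R `^ s * expR (- n.+1%:R)))%:E +
   s%:E * \int[mu]_(t in `[0%R, n.+1%:R]) (t `^ (s - 1) * expR (- t))%:E)%E.
  by apply/funext => n; rewrite gamma_parts.
rewrite e12 in h1; rewrite -[RHS]add0e.
exact: (@cvg_unique _ (@ereal_hausdorff R) _ _ _ _ h1 h2).
Qed.

(** The recurrence holds for the extended integrals, finite or not; [fine] sends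
    an infinite value to [0] on both sides. *)
Lemma GammaD1 (s : R) : 1 <= s -> Gamma (s + 1) = s * Gamma s.
Proof.
move=> s1; rewrite /Gamma /Rintegral -/(egamma (s + 1)) -/(egamma s) egammaD1//.
have : (0 <= egamma s)%E.
  by apply: integral_ge0 => t _; rewrite lee_fin mulr_ge0 ?powR_ge0 ?expR_ge0.
case: (egamma s) => [r| |] //= _; rewrite gt0_muley ?lte_fin ?mulr0//; lra.
Qed.

Lemma Gamma_ge0 (s : R) : 0 <= Gamma s.
Proof. by apply: Rintegral_ge0 => t _; rewrite mulr_ge0 ?powR_ge0 ?expR_ge0. Qed.

End gamma.

(** * Bessel functions and the root of the boundary equation *)

Section bessel.
Context {R : realType}.
Implicit Types (nu x z : R).

Lemma Gamma_shift nu k : 0 <= nu ->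
  Gamma (k%:R + nu + 1) = Gamma (nu + 1) * \prod_(i < k) (nu + 1 + i%:R).
Proof.
move=> nu0; elim: k => [|k ih]; first by rewrite big_ord0 add0r mulr1.
rewrite big_ord_recr/= mulrA -ih -natr1.
have -> : k%:R + 1 + nu + 1 = (k%:R + nu + 1) + 1 by ring.
rewrite GammaD1; first by ring.
by rewrite lerDr addr_ge0.
Qed.

(** By [Gamma_shift] the factor [Gamma (nu + 1)] splits off every coefficient. *)
Lemma besselJE nu x : 0 <= nu -> 0 < x ->
  besselJ nu x = (x / 2) `^ nu / Gamma (nu + 1) * hyp (nu + 1) (x ^+ 2 / 4).
Proof.
move=> nu0 x0; have nu1 : 1 <= nu + 1 by rewrite lerDr.
have cv := @exp_bounded_cvg _ _ (x ^+ 2 / 4) (hyp_coef_bounded nu1).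
apply/cvg_lim => //.
set C := (x / 2) `^ nu / Gamma (nu + 1).
rewrite (_ : series _ = (fun n => C * pseries (hyp_coef (nu + 1)) (x ^+ 2 / 4) n)).
  by apply: cvgM; [exact: cvg_cst|exact: cv].
apply/funext => n; rewrite /pseries /series/= mulr_sumr; apply: eq_bigr => k _.
rewrite Gamma_shift// /hyp_coef /C.
have -> : (x / 2) `^ (2 * k%:R + nu) = (x / 2) `^ nu * (x ^+ 2 / 4) ^+ k.
  rewrite powRD; last by rewrite (gt_eqF (x := x / 2)) ?implybT// divr_gt0.
  rewrite mulrC powRrM powR_mulrn ?powR_ge0//; congr (_ * _ ^+ _).
  rewrite powR_mulrn ?divr_ge0 ?(ltW x0)// expr_div_n; congr (_ / _).
  by rewrite -natrX.
by rewrite !invfM; ring.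
Qed.

Lemma besselJ_neq0 nu x : 0 < x < bessel_zero nu -> besselJ nu x != 0.
Proof.
move=> /andP[x0 xz]; apply/negP => /eqP J0; move: xz; rewrite ltNge => /negP; apply.
by apply: ge_inf => //; exists 0 => y [/ltW].
Qed.

(** If the integral degenerated to [0], then so would [J_nu], and no number would
    lie strictly between [0] and the first zero. *)
Lemma Gamma_gt0_below_zero nu x : 0 <= nu -> 0 < x < bessel_zero nu -> 0 < Gamma (nu + 1).
Proof.
move=> nu0 /[dup] xz /andP[x0 _]; rewrite lt_neqAle Gamma_ge0 andbT eq_sym.
apply: contraNneq (besselJ_neq0 xz) => G0.
by rewrite besselJE// G0 invr0 mulr0 mul0r.
Qed.

(** [u] starts from [u 0 = 1] and a zero of [u] is a zero of [J_nu]. *)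
Lemma hyp_gt0 nu z : 0 <= nu -> 0 < z < bessel_zero nu ->
  forall s, 0 <= s <= z ^+ 2 / 4 -> 0 < hyp (nu + 1) s.
Proof.
move=> nu0 /andP[z0 zj]; have nu1 : 1 <= nu + 1 by rewrite lerDr.
have neq0 s : 0 < s <= z ^+ 2 / 4 -> hyp (nu + 1) s != 0.
  move=> /andP[s0 sz]; pose x := 2 * Num.sqrt s.
  have x0 : 0 < x by rewrite mulr_gt0// sqrtr_gt0.
  have x2 : x ^+ 2 / 4 = s by rewrite /x exprMn sqr_sqrtr ?(ltW s0)//; field.
  have xz : x <= z.
    by rewrite -(ler_pXn2r (n := 2)) ?nnegrE ?(ltW x0) ?(ltW z0)//; move: sz; rewrite -x2; lra.
  have := @besselJ_neq0 nu x; rewrite x0 (le_lt_trans xz zj) => /(_ isT).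
  by apply: contraNneq => h; rewrite besselJE// x2 h mulr0.
move=> s /andP[s0 sz]; rewrite ltNge; apply/negP => hs.
have cw : {within `[0, s], continuous (hyp (nu + 1))}.
  exact/continuous_subspaceT/continuous_hyp.
have [|r] := IVT s0 cw (v := 0).
  by rewrite hyp0// ge_min le_max ler01 hs orbT.
rewrite in_itv/= => /andP[r0 rs] hr.
move: r0; rewrite le_eqVlt => /predU1P[r0|r0].
  by move: hr; rewrite -r0 hyp0// => /eqP; rewrite oner_eq0.
by have := neq0 r; rewrite r0 (le_trans rs sz) hr eqxx => /(_ isT).
Qed.

Lemma derive_besselJ nu z : 0 <= nu -> 0 < z ->
  z * derive1 (besselJ nu) z = (z / 2) `^ nu / Gamma (nu + 1) *
    (nu * hyp (nu + 1) (z ^+ 2 / 4) + z ^+ 2 / 2 * hyp' (nu + 1) (z ^+ 2 / 4)).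
Proof.
move=> nu0 z0; have nu1 : 1 <= nu + 1 by rewrite lerDr.
set t := z ^+ 2 / 4; set G := Gamma _; have z20 : 0 < z / 2 by rewrite divr_gt0.
have D0 : is_derive z 1 (fun x : R => x / 2) 2^-1.
  have D := is_deriveM (is_derive_id z (1 : R)) (is_derive_cst (2^-1 : R) z (1 : R)).
  by rewrite scaler0 add0r [_ *: _]mulr1 in D; exact: D.
have D1 : is_derive z 1 (fun x => (x / 2) `^ nu) (nu * (z / 2) `^ (nu - 1) * 2^-1).
  exact: (@is_derive1_comp R (fun y => y `^ nu) (fun x => x / 2) z _ _ (is_derive1_powR nu z20) D0).
have D2 : is_derive z 1 (fun x : R => x ^+ 2 / 4) (z / 2).
  have D := is_deriveM (is_deriveM (is_derive_id z (1 : R)) (is_derive_id z (1 : R)))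
    (is_derive_cst (4^-1 : R) z (1 : R)).
  have e : ((id * id) z *: (0 : R) + (cst (4^-1 : R)) z *: (z *: (1 : R) + z *: (1 : R))) = z / 2.
    by rewrite scaler0 add0r /GRing.scale/=; field.
  by rewrite e in D; exact: D.
have D3 : is_derive z 1 (fun x => hyp (nu + 1) (x ^+ 2 / 4)) (hyp' (nu + 1) t * (z / 2)).
  exact: (@is_derive1_comp R (hyp (nu + 1)) (fun x => x ^+ 2 / 4) z _ _ (is_derive_hyp nu1 t) D2).
have D4 : is_derive z 1 (besselJ nu) (G^-1 * ((z / 2) `^ nu * (hyp' (nu + 1) t * (z / 2)) + 
     hyp (nu + 1) t * (nu * (z / 2) `^ (nu - 1) * 2^-1))).
  apply: (@near_eq_is_derive _ _ _ (fun x => G^-1 * ((x / 2) `^ nu * hyp (nu + 1) (x ^+ 2 / 4)))).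
    near=> x; rewrite besselJE//; last by near: x; exact: lt_nbhsr.
    by rewrite mulrA; congr (_ * _); rewrite mulrC.
  exact: is_deriveZ (is_deriveM D1 D3).
rewrite derive1E; have [_ ->] := D4.
have : (z / 2) `^ (nu - 1) * (z / 2) = (z / 2) `^ nu.
  rewrite powRB; last by rewrite (gt_eqF z20) implybT.
  by rewrite powRr1 ?(ltW z20)// mulfVK// gt_eqF.
move=> <-; ring.
Unshelve. all: by end_near. Qed.

(** The equation for [c], divided by [(z / 2)^nu / Gamma (nu + 1)] and written in
    the variable [t = z^2 / 4 = c^2 / m^2]. *)
Lemma bessel_root_hyp (m nu lambda c : R) : 0 < m -> 0 <= nu ->
  0 < 2 / m * c < bessel_zero nu ->
  (1 - 2 * lambda) * besselJ nu (2 / m * c)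
      + 2 * c * derive1 (besselJ nu) (2 / m * c) = 0 ->
  let t := c ^+ 2 / m ^+ 2 in [/\ 0 < c, 0 < t,
   forall s, 0 <= s <= t -> 0 < hyp (nu + 1) s &
   (1 - 2 * lambda + m * nu) * hyp (nu + 1) t + 2 * m * t * hyp' (nu + 1) t = 0].
Proof.
move=> m0 nu0 /[dup] zj /andP[+ _]; set z := 2 / m * c => z0 eq t.
have cE : 2 * c = m * z by rewrite /z; field; rewrite gt_eqF.
have c0 : 0 < c by rewrite -(pmulr_rgt0 c (ltr0n _ 2)) cE mulr_gt0.
have tE : z ^+ 2 / 4 = t by rewrite /t /z; field; rewrite gt_eqF.
split => //.
- by rewrite /t divr_gt0// exprn_gt0.
- by move=> s; rewrite -tE; exact: hyp_gt0 nu0 zj s.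
- move: eq; rewrite cE -[m * z * _]mulrA derive_besselJ// besselJE// tE.
  set B := (z / 2) `^ nu / Gamma (nu + 1).
  have B0 : B != 0.
    by rewrite gt_eqF// divr_gt0 ?powR_gt0 ?divr_gt0//; exact: Gamma_gt0_below_zero zj.
  have -> : z ^+ 2 / 2 = 2 * t by rewrite -tE; field.
  set Q := _ + _ => Q0; apply: (mulfI B0); rewrite mulr0 -[RHS]Q0 /Q; ring.
Qed.

End bessel.

(** * The two profiles *)

Section profiles.
Context {R : realType}.
Notation mu := (@lebesgue_measure R).

Lemma two_weight_integral (a b : R) (g : R -> R) (m c1 c2 : R) : a < b -> abs_cont a b g ->
  0 <= c1 -> 0 <= c2 ->
  (c1%:E * (\int[mu]_(x in `[a, b]) (`|g x| ^+ 2 / bdist a b x ^+ 2)%:E) +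
   c2%:E * (\int[mu]_(x in `[a, b]) (`|g x| ^+ 2 / bdist a b x `^ (2 - m))%:E) =
   \int[mu]_(x in `[a, b])
     ((fun s => c1 / s ^+ 2 + c2 / s `^ (2 - m)) (bdist a b x) * g x ^+ 2)%:E)%E.
Proof.
move=> ab gac c10 c20; pose h := g \o clamp a b.
have hg x : x \in `[a, b]%classic -> g x = h x.
  by rewrite inE/= in_itv/= => xab; rewrite /h /= clamp_id.
have hc : continuous h by exact: abs_cont_continuous (abs_cont_clamp (ltW ab) gac).
have mh : measurable_fun setT (fun x => `|h x| ^+ 2).
  apply: measurable_funX; apply: measurableT_comp => //; exact: continuous_measurable_fun.
have mdist : measurable_fun setT (bdist a b).
  by apply: measurable_minr; exact: measurable_funB.
have mp (q : R) : measurable_fun setT (fun x => (bdist a b x `^ q)).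
  by apply: (measurableT_comp (measurable_powR q)).
have d0 x : x \in `[a, b]%classic -> 0 <= bdist a b x.
  by rewrite inE/= in_itv/= => /andP[ax xb]; rewrite /bdist le_min !subr_ge0 ax xb.
have mI : measurable (`[a, b] : set (measurableTypeR R)) by exact: measurable_itv.
have e1 : (\int[mu]_(x in `[a, b]) (`|g x| ^+ 2 / bdist a b x ^+ 2)%:E =
    \int[mu]_(x in `[a, b]) (`|h x| ^+ 2 * bdist a b x `^ (- 2))%:E)%E.
  by apply: eq_integral => x xab; rewrite -hg// powRN powR_mulrn// d0.
have e2 : (\int[mu]_(x in `[a, b]) (`|g x| ^+ 2 / bdist a b x `^ (2 - m))%:E =
    \int[mu]_(x in `[a, b]) (`|h x| ^+ 2 * bdist a b x `^ (m - 2))%:E)%E.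
  by apply: eq_integral => x xab; rewrite -hg// -opprB powRN invrK.
have ms (q : R) : measurable_fun `[a, b] (fun x => (`|h x| ^+ 2 * bdist a b x `^ q)%:E).
  by apply/measurable_EFinP; apply: measurable_funTS; apply: measurable_funM.
have n0 (q x : R) : 0 <= `|h x| ^+ 2 * bdist a b x `^ q by rewrite mulr_ge0 ?powR_ge0 ?exprn_ge0.
rewrite e1 e2 -ge0_integralZl//; last by move=> x _; rewrite lee_fin; exact: n0.
rewrite -ge0_integralZl//; last by move=> x _; rewrite lee_fin; exact: n0.
rewrite -ge0_integralD//.
- apply: eq_integral => x xab; rewrite -!EFinM -EFinD; congr EFin.
  rewrite -hg// real_normK ?num_real// powRN (powR_mulrn 2) ?d0//.
  by rewrite -[m - 2]opprB powRN; ring.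
- by move=> x _; rewrite mule_ge0 ?lee_fin//; exact: n0.
- by apply: measurable_funeM; exact: ms.
- by move=> x _; rewrite mule_ge0 ?lee_fin//; exact: n0.
- by apply: measurable_funeM; exact: ms.
- exact: ms.
- exact: ms.
Qed.

Lemma measurable_weight (m c1 c2 : R) :
  measurable_fun setT (fun s : R => c1 / s ^+ 2 + c2 / s `^ (2 - m)).
Proof.
have -> : (fun s : R => c1 / s ^+ 2 + c2 / s `^ (2 - m)) =
    (fun s => c1 * `|s| `^ (- 2) + c2 * s `^ (m - 2)).
  apply/funext => s; rewrite powRN powR_mulrn// real_normK ?num_real//.
  by rewrite -[m - 2]opprB powRN.
apply: measurable_funD.
  apply: measurable_funM; first exact: measurable_cst.
  by apply: (measurableT_comp (measurable_powR (- 2))).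
by apply: measurable_funM; [exact: measurable_cst|exact: measurable_powR].
Qed.

Lemma continuous_powR_gt0 (p s : R) : 0 < s -> {for s, continuous (fun x : R => x `^ p)}.
Proof.
move=> s0; have [+ _] := is_derive1_powR p s0.
by move=> /derivable1_diffP/differentiable_continuous.
Qed.

(** Powers of [s] are expressed through [s ^ (m - 2)], so that identities between
    them become identities of rational functions. *)
Lemma powR_m1 (m s : R) : 0 < s -> s `^ (m - 1) = s `^ (m - 2) * s.
Proof.
move=> s0; have -> : m - 1 = (m - 2) + 1 by ring.
by rewrite powRD ?powRr1 ?(ltW s0)// (gt_eqF s0) implybT.
Qed.

Lemma powR_m (m s : R) : 0 < s -> s `^ m = s `^ (m - 2) * s ^+ 2.
Proof.
move=> s0; have -> : m = (m - 1) + 1 by ring.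
rewrite powRD ?powRr1 ?(ltW s0)// ?(gt_eqF s0) ?implybT//.
by rewrite powR_m1// (_ : m - 1 + 1 - 2 = m - 2); ring.
Qed.

Section profile1.
Variables (m D : R).

Definition power_profile (s : R) : R := 2^-1 * (s^-1 - D * s `^ (m - 1)).
Definition power_profile' (s : R) : R := 2^-1 * (- s ^- 2 - D * ((m - 1) * s `^ (m - 2))).

Lemma is_derive_power_profile (s : R) : 0 < s -> is_derive s 1 power_profile (power_profile' s).
Proof.
move=> s0.
have D1 : is_derive s 1 (fun x : R => x^-1) (- s ^- 2 *: (1 : R)).
  by apply: is_deriveV; rewrite gt_eqF.
have D2 := is_deriveZ D (is_derive1_powR (m - 1) s0).
have D3 := is_deriveZ 2^-1 (is_deriveB D1 D2).
have e : 2^-1 *: (- s ^- 2 *: (1 : R) - D *: ((m - 1) * s `^ (m - 1 - 1))) = power_profile' s.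
  rewrite /GRing.scale/= /power_profile' (_ : m - 1 - 1 = m - 2); ring.
by rewrite e in D3; exact: D3.
Qed.

Lemma continuous_power_profile' (s : R) : 0 < s -> {for s, continuous power_profile'}.
Proof.
move=> s0; apply: cvgM; first exact: cvg_cst.
apply: cvgB.
  apply: cvgN; apply: cvgV; first by rewrite expf_neq0// gt_eqF.
  exact: exprn_continuous.
by apply: cvgM; [exact: cvg_cst|apply: cvgM; [exact: cvg_cst|exact: continuous_powR_gt0]].
Qed.

End profile1.

Section profile2.
Variables (p m tau kappa : R).
Hypothesis m1 : 1 <= kappa.
Notation u := (hyp kappa).
Notation u' := (hyp' kappa).
Notation u'' := (hyp'' kappa).

(** The logarithmic derivative of [u]. *)
Definition ratio (y : R) : R := u' y / u y.
Definition ratio' (y : R) : R := u'' y / u y - ratio y ^+ 2.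

Lemma is_derive_ratio (y : R) : u y != 0 -> is_derive y 1 ratio (ratio' y).
Proof.
move=> uy.
have D2 : is_derive y 1 (fun x => (u x)^-1) (- u y ^- 2 *: u' y).
  by apply: is_deriveV => //; exact: is_derive_hyp.
have D := is_deriveM (is_derive_hyp' m1 y) D2.
have e : u' y *: (- u y ^- 2 *: u' y) + (u y)^-1 *: u'' y = ratio' y.
  by rewrite /GRing.scale/= /ratio' /ratio; field.
by rewrite e in D; exact: D.
Qed.

Lemma continuous_ratio' (y : R) : u y != 0 -> {for y, continuous ratio'}.
Proof.
move=> uy; apply: cvgB.
  apply: cvgM; first exact: continuous_hyp''.
  by apply: cvgV => //; exact: continuous_hyp.
have [+ _] := is_derive_ratio uy => /derivable1_diffP/differentiable_continuous cr.
by apply: cvgM; exact: cr.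
Qed.

(** The logarithmic derivative of [s^p u (tau s^m)], that is, of
    [s^(1/2) J_nu ((2 c / m) (s / d)^(m / 2))] up to a constant factor if
    [tau = (c / m)^2 / d^m]. *)
Definition bessel_profile (s : R) : R := p * s^-1 + m * tau * (s `^ (m - 1) * ratio (tau * s `^ m)).
Definition bessel_profile' (s : R) : R := p * - s ^- 2 + m * tau *
  (s `^ (m - 1) * (ratio' (tau * s `^ m) * (tau * (m * s `^ (m - 1))))
   + ratio (tau * s `^ m) * ((m - 1) * s `^ (m - 2))).

Lemma is_derive_bessel_profile (s : R) : 0 < s -> u (tau * s `^ m) != 0 ->
  is_derive s 1 bessel_profile (bessel_profile' s).
Proof.
move=> s0 us.
have D1 : is_derive s 1 (fun x : R => x^-1) (- s ^- 2 *: (1 : R)).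
  by apply: is_deriveV; rewrite gt_eqF.
have Dy := is_deriveZ tau (is_derive1_powR m s0).
have Dr : is_derive s 1 (fun x => ratio (tau * x `^ m))
    (ratio' (tau * s `^ m) * (tau *: (m * s `^ (m - 1)))).
  exact: (@is_derive1_comp R ratio (fun x => tau * x `^ m) s _ _ (is_derive_ratio us) Dy).
have D := is_deriveD (is_deriveZ p D1)
  (is_deriveZ (m * tau) (is_deriveM (is_derive1_powR (m - 1) s0) Dr)).
have e : p *: (- s ^- 2 *: (1 : R)) + (m * tau) *: (s `^ (m - 1) *:
    (ratio' (tau * s `^ m) * (tau *: (m * s `^ (m - 1)))) +
    ratio (tau * s `^ m) *: ((m - 1) * s `^ (m - 1 - 1))) = bessel_profile' s.
  rewrite /GRing.scale/= /bessel_profile' (_ : m - 1 - 1 = m - 2); ring.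
by rewrite e in D; exact: D.
Qed.

Lemma continuous_bessel_profile' (s : R) : 0 < s -> u (tau * s `^ m) != 0 ->
  {for s, continuous bessel_profile'}.
Proof.
move=> s0 us.
have cy : {for s, continuous (fun x => tau * x `^ m)}.
  by apply: cvgM; [exact: cvg_cst|exact: continuous_powR_gt0].
have cr : {for s, continuous (fun x => ratio (tau * x `^ m))}.
  apply: (@continuous_comp _ _ _ (fun x => tau * x `^ m) ratio) => //.
  by have [+ _] := is_derive_ratio us => /derivable1_diffP/differentiable_continuous.
have cdr : {for s, continuous (fun x => ratio' (tau * x `^ m))}.
  apply: (@continuous_comp _ _ _ (fun x => tau * x `^ m) ratio') => //.
  exact: continuous_ratio'.
have cp (q : R) : {for s, continuous (fun x : R => x `^ q)} by exact: continuous_powR_gt0.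
apply: cvgD.
  apply: cvgM; first exact: cvg_cst.
  apply: cvgN; apply: cvgV; first by rewrite expf_neq0// gt_eqF.
  exact: exprn_continuous.
apply: cvgM; first exact: cvg_cst.
apply: cvgD.
  apply: cvgM; first exact: cp.
  apply: cvgM; first exact: cdr.
  apply: cvgM; first exact: cvg_cst.
  by apply: cvgM; [exact: cvg_cst|exact: cp].
apply: cvgM; first exact: cr.
by apply: cvgM; [exact: cvg_cst|exact: cp].
Qed.

Lemma mul_bessel_profile (s : R) : 0 < s ->
  s * bessel_profile s = p + m * (tau * s `^ m) * ratio (tau * s `^ m).
Proof.
move=> s0; rewrite /bessel_profile powR_m1// (powR_m m s0).
by generalize (ratio (tau * (s `^ (m - 2) * s ^+ 2))) => r1; field; rewrite gt_eqF.
Qed.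

(** [y ratio' (y)] is eliminated with the differential equation of [u]; the terms
    linear in [ratio] cancel exactly for this value of [kappa]. *)
Lemma bessel_profile_riccati (s : R) : kappa = 1 + (2 * p - 1) / m -> m != 0 -> 0 < s ->
  u (tau * s `^ m) != 0 ->
  s ^+ 2 * (bessel_profile' s + bessel_profile s ^+ 2) = p ^+ 2 - p - m ^+ 2 * (tau * s `^ m).
Proof.
move=> kappaE m0 s0 us; set y := tau * s `^ m in us *.
have sn0 : s != 0 by rewrite gt_eqF.
have ode := hyp_ode m1 y.
have yE : y = tau * (s `^ (m - 2) * s ^+ 2) by rewrite /y (powR_m m s0).
have e1 : s * bessel_profile s = p + m * y * ratio y by rewrite mul_bessel_profile.
have e2 : s ^+ 2 * bessel_profile' s = - p + m ^+ 2 * y ^+ 2 * ratio' y + m * (m - 1) * y * ratio y.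
  rewrite /bessel_profile' -/y powR_m1//; generalize (ratio y) (ratio' y) => r1 r2.
  by rewrite yE; field.
have e3 : y ^+ 2 * ratio' y = - y * (kappa * ratio y + 1) - y ^+ 2 * ratio y ^+ 2.
  have -> : y ^+ 2 * ratio' y = y * ((y * u'' y) / u y) - y ^+ 2 * ratio y ^+ 2.
    by rewrite /ratio'; ring.
  have -> : y * u'' y = - (kappa * u' y) - u y by lra.
  by rewrite /ratio; field.
have -> : s ^+ 2 * (bessel_profile' s + bessel_profile s ^+ 2) = s ^+ 2 * bessel_profile' s + (s * bessel_profile s) ^+ 2 by ring.
by rewrite e1 e2 -[m ^+ 2 * y ^+ 2 * _]mulrA e3 kappaE; field.
Qed.

End profile2.
End profiles.

(** * The bound on the root and the theorem *)

Section root_and_weights.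
Context {R : realType}.
Notation mu := (@lebesgue_measure R).

(** If the set of roots is empty, its infimum is [0] and [t = 0] works. Otherwise
    any root [c] bounds the infimum from above, with [t = c^2 / m^2]; nothing has
    to be known about the infimum being attained. *)
Lemma bessel_rootP (m nu la : R) : 0 < m -> 0 <= nu ->
  exists t, [/\ 0 <= t, 0 <= bessel_root m nu la,
    bessel_root m nu la ^+ 2 <= m ^+ 2 * t,
    forall s, 0 <= s <= t -> 0 < hyp (nu + 1) s &
    t = 0 \/ 0 < t /\ ((1 + nu * m) / 2 - la) * hyp (nu + 1) t + m * t * hyp' (nu + 1) t = 0].
Proof.
move=> m0 nu0; have nu1 : 1 <= nu + 1 by rewrite lerDr.
pose E := [set c : R | 0 < 2 / m * c < bessel_zero nu /\
    (1 - 2 * la) * besselJ nu (2 / m * c) + 2 * c * derive1 (besselJ nu) (2 / m * c) = 0].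
have Epos c : E c -> 0 < c.
  by move=> [/andP[+ _] _]; rewrite pmulr_rgt0// divr_gt0.
have [[c Ec]|nE] := pselect (exists c, E c).
  have [c0 t0 pos eq] := bessel_root_hyp m0 nu0 (proj1 Ec) (proj2 Ec).
  have b0 : 0 <= bessel_root m nu la.
    by apply: lb_le_inf; [exists c|move=> x /Epos/ltW].
  have bc : bessel_root m nu la <= c.
    by apply: ge_inf => //; exists 0 => x /Epos/ltW.
  exists (c ^+ 2 / m ^+ 2); split => //.
  - exact: ltW.
  - by rewrite mulrC divfK ?expf_neq0 ?gt_eqF// lerXn2r// ?nnegrE// ltW.
  - right; split => //; move: eq.
    by set h := hyp _ _; set h' := hyp' _ _ => eq; rewrite -(mul0r 2^-1) -eq; field; rewrite gt_eqF.
have br0 : bessel_root m nu la = 0.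
  rewrite /bessel_root -/E (_ : E = set0) ?inf0//.
  by apply/seteqP; split => // c Ec; apply: nE; exists c.
exists 0; rewrite br0 expr0n mulr0 !lexx; split => //; last by left.
by move=> s; rewrite -eq_le => /eqP <-; rewrite hyp0.
Qed.

(** [m t (- u') = (p - lambda) u <= (p - lambda) (nu + 1) (- u')] at the root. *)
Lemma bessel_root_le (m nu la : R) : 0 < m -> 0 <= nu -> la < (1 + nu * m) / 2 ->
  bessel_root m nu la ^+ 2 <= (m + nu * m) * ((1 + nu * m) / 2 - la).
Proof.
move=> m0 nu0 lap; have nu1 : 1 <= nu + 1 by rewrite lerDr.
have num0 : 0 <= nu * m by rewrite mulr_ge0// ltW.
have [t [t0 b0 bt pos]] := bessel_rootP la m0 nu0.
set q := _ / 2 - la; have q0 : 0 < q by rewrite subr_gt0.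
move=> [tE|[{}t0 eq]].
  by rewrite (le_trans bt)// tE mulr0 mulr_ge0 ?(ltW q0)// addr_ge0// ltW.
apply: le_trans bt _; have := @hyp_le R _ nu1 t pos t; rewrite t0 lexx => /(_ isT) hle.
have ht : 0 < hyp (nu + 1) t by apply: pos; rewrite ltW//=.
set h' := hyp' _ _ in eq hle; set h := hyp _ _ in ht eq hle.
have h'0 : 0 < - h' by rewrite -(pmulr_rgt0 _ (lt_le_trans ltr01 nu1)); lra.
have : m * t <= (nu + 1) * q.
  rewrite -(ler_pM2r h'0).
  have -> : m * t * - h' = q * h by lra.
  have -> : (nu + 1) * q * - h' = q * (- (nu + 1) * h') by ring.
  by rewrite ler_wpM2l// ltW.
move=> /(ler_wpM2l (ltW m0)).
have -> : m * (m * t) = m ^+ 2 * t by ring.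
by have -> : m * ((nu + 1) * q) = (m + nu * m) * q by ring.
Qed.

(** After inserting the bound on [c2], the difference of the two sides is at least
    [(p^2 - la^2) (1 - r) + (m (p - la^2) - (p - la)^2) r]. *)
Lemma weights_le_of_root_bound (p la m c2 r : R) : 0 <= la -> la < p -> p <= 1 -> 1 < m -> 0 <= r <= 1 ->
  c2 <= (m + (2 * p - 1)) * (p - la) ->
  (p - p ^+ 2) + (c2 + (m - 1) * (la - la ^+ 2)) * r <=
  (p - la ^+ 2) * (1 + 2 * m * r - r ^+ 2).
Proof.
move=> la0 lap p1 m1 /andP[r0 r1] c2le.
have k0 : 0 <= p - la ^+ 2 by nra.
have h1 : (p - la ^+ 2) * r ^+ 2 <= (p - la ^+ 2) * r by rewrite ler_wpM2l//; nra.
have h2 : (c2 + (m - 1) * (la - la ^+ 2)) * r <=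
    ((m + (2 * p - 1)) * (p - la) + (m - 1) * (la - la ^+ 2)) * r.
  by rewrite ler_wpM2r// lerD2r.
have h3 : (p - la) ^+ 2 <= m * (p - la ^+ 2).
  have : (p - la) ^+ 2 <= p - la ^+ 2 by nra.
  by move=> /le_trans; apply; rewrite ler_peMl// ltW.
have h4 : (p - la) ^+ 2 * r <= m * (p - la ^+ 2) * r by rewrite ler_wpM2r.
have h5 : (p ^+ 2 - la ^+ 2) * r <= p ^+ 2 - la ^+ 2 by rewrite ler_piMr//; nra.
nra.
Qed.

Lemma powR_ratio (m s d : R) : 0 < m -> 0 < s <= d -> 0 < (d `^ m)^-1 * s `^ m <= 1.
Proof.
move=> m0 /andP[s0 sd]; have d0 := lt_le_trans s0 sd.
rewrite mulr_gt0 ?invr_gt0 ?powR_gt0//= mulrC ler_pdivrMr ?powR_gt0// mul1r.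
by rewrite ge0_ler_powR ?nnegrE// ltW.
Qed.

Lemma power_profile_riccati (d m k al C s : R) : 0 < m -> 0 < s <= d ->
  (forall r, 0 <= r <= 1 -> al + C * r <= k * (1 + 2 * m * r - r ^+ 2)) ->
  al / s ^+ 2 + C / d `^ m / s `^ (2 - m) +
   (4 * k) * (power_profile' m (d `^ m)^-1 s + power_profile m (d `^ m)^-1 s ^+ 2) <= 0.
Proof.
move=> m0 sd H; have [s0 _] := andP sd.
have := powR_ratio m0 sd; set D := (d `^ m)^-1 => /andP[r0 r1].
have := H (D * s `^ m); rewrite (ltW r0) r1 => /(_ isT).
have s20 : 0 < s ^+ 2 by rewrite exprn_gt0.
rewrite -(pmulr_rle0 _ s20) -[2 - m]opprB powRN invrK /power_profile /power_profile' powR_m1// powR_m//.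
set P := s `^ (m - 2) => HP.
rewrite [X in X <= 0](_ : _ = al + C * (D * (P * s ^+ 2)) -
   k * (1 + 2 * m * (D * (P * s ^+ 2)) - (D * (P * s ^+ 2)) ^+ 2)) ?subr_le0//.
by field; rewrite gt_eqF.
Qed.

End root_and_weights.

Theorem theorem3 (R : realType) (a b : R) (hab : a < b) (g : R -> R)
    (hg : abs_cont a b g) (hga : g a = 0) (hgb : g b = 0) :
  let mu := @lebesgue_measure R in
  let delta := bdist a b in
  let delta0 := (b - a) / 2 in
  (forall m nu lambda : R,
     1 < m -> 0 <= nu <= 1 / m -> 0 <= lambda < (1 + nu * m) / 2 ->
     (((1 - nu ^+ 2 * m ^+ 2) / 4)%:E *
        (\int[mu]_(x in `[a, b]) (`|g x| ^+ 2 / delta x ^+ 2)%:E)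
      + ((bessel_root m nu lambda ^+ 2 + (m - 1) * (lambda - lambda ^+ 2))
           / delta0 `^ m)%:E *
        (\int[mu]_(x in `[a, b]) (`|g x| ^+ 2 / delta x `^ (2 - m))%:E)
      <= (4 * ((1 + nu * m) / 2 - lambda ^+ 2))%:E *
        (\int[mu]_(x in `[a, b]) (`|derive1 g x| ^+ 2)%:E))%E)
  /\
  (forall m nu lambda : R,
     0 < m -> 0 <= nu < 1 / m -> lambda <= 0 ->
     (((1 - nu ^+ 2 * m ^+ 2) / 4)%:E *
        (\int[mu]_(x in `[a, b]) (`|g x| ^+ 2 / delta x ^+ 2)%:E)
      + (bessel_root m nu lambda ^+ 2 / delta0 `^ m)%:E *
        (\int[mu]_(x in `[a, b]) (`|g x| ^+ 2 / delta x `^ (2 - m))%:E)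
      <= (2 * (1 + nu * m) + `|lambda|)%:E *
        (\int[mu]_(x in `[a, b]) (`|derive1 g x| ^+ 2)%:E))%E).
Proof.
move=> mu delta delta0.
have d0 : 0 < delta0 by rewrite divr_gt0// subr_gt0.
split=> m nu la.
  move=> m1 /andP[nu0 num] /andP[la0 lap].
  have m0 : 0 < m by lra.
  have num0 : 0 <= nu * m by rewrite mulr_ge0// ltW.
  have num1 : nu * m <= 1 by rewrite -ler_pdivlMr.
  have brle := bessel_root_le m0 nu0 lap.
  have alE : (1 - nu ^+ 2 * m ^+ 2) / 4 = (1 + nu * m) / 2 - ((1 + nu * m) / 2) ^+ 2 by field.
  rewrite alE; set p := (1 + nu * m) / 2 in lap brle *.
  set br := bessel_root m nu la in brle *.
  have p1 : p <= 1 by rewrite /p; lra.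
  have p0 : 0 < p by rewrite /p; lra.
  have al0 : 0 <= p - p ^+ 2 by nra.
  have C0 : 0 <= br ^+ 2 + (m - 1) * (la - la ^+ 2).
    by rewrite addr_ge0 ?sqr_ge0// mulr_ge0//; [lra|nra].
  have k0 : 0 < p - la ^+ 2 by nra.
  have dm0 : 0 < delta0 `^ m by rewrite powR_gt0.
  rewrite two_weight_integral// ?divr_ge0 ?(ltW dm0)//.
  (* the power profile vanishes at the midpoint, hence [L = 0] *)
  rewrite -[4 * (p - la ^+ 2)]mulr1 -[X in (_ * X)%:E]addr0.
  apply: (@hardy_of_profile R a b g (power_profile m (delta0 `^ m)^-1) (power_profile' m (delta0 `^ m)^-1)
    (fun s => (p - p ^+ 2) / s ^+ 2 + (br ^+ 2 + (m - 1) * (la - la ^+ 2)) / delta0 `^ m / s `^ (2 - m))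
    (4 * (p - la ^+ 2)) 1 0) => //.
  - by rewrite mulr_gt0.
  - by move=> s /andP[s0 _]; exact: is_derive_power_profile.
  - by move=> s /andP[s0 _]; exact: continuous_power_profile'.
  - move=> s sd; have [s0 _] := andP sd; have /andP[r0 _] := powR_ratio m0 sd.
    rewrite /power_profile (powR_m1 m s0); move: r0; rewrite (powR_m m s0); set P := s `^ (m - 2); set D := (delta0 `^ m)^-1 => r0.
    have -> : s * (2^-1 * (s^-1 - D * (P * s))) = (1 - D * (P * s ^+ 2)) / 2 by field; rewrite gt_eqF.
    lra.
  - rewrite add0r /power_profile mulrCA mulr_ge0// mulrBr divff ?gt_eqF// mulrCA.
    have -> : delta0 * delta0 `^ (m - 1) = delta0 `^ m by rewrite mulr_powRB1// ltW.
    by rewrite mulVf ?gt_eqF// subrr.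
  - exact: measurable_weight.
  - move=> s /andP[s0 _]; rewrite addr_ge0// divr_ge0 ?powR_ge0 ?sqr_ge0//.
    by rewrite divr_ge0// ltW.
  - move=> s sd; apply: power_profile_riccati => // r r01.
    apply: weights_le_of_root_bound => //; rewrite (le_trans brle)// /p; lra.
move=> m0 /andP[nu0 num] la0.
have num0 : 0 <= nu * m by rewrite mulr_ge0// ltW.
have num1 : nu * m <= 1 by rewrite -ler_pdivlMr// ltW.
have nu1 : 1 <= nu + 1 by rewrite lerDr.
have alE : (1 - nu ^+ 2 * m ^+ 2) / 4 = (1 + nu * m) / 2 - ((1 + nu * m) / 2) ^+ 2 by field.
have [t [t0 b0 bt pos eq]] := bessel_rootP la m0 nu0.
rewrite alE; set p := (1 + nu * m) / 2 in eq *.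
set br := bessel_root m nu la in b0 bt *.
have p1 : p <= 1 by rewrite /p; lra.
have p0 : 0 < p by rewrite /p; lra.
have al0 : 0 <= p - p ^+ 2 by nra.
have dm0 : 0 < delta0 `^ m by rewrite powR_gt0.
have C0 : 0 <= br ^+ 2 / delta0 `^ m by rewrite divr_ge0 ?sqr_ge0// ltW.
pose D := (delta0 `^ m)^-1; pose tau := t * D.
have yt s : 0 < s <= delta0 -> 0 <= tau * s `^ m <= t.
  move=> /(powR_ratio m0) /andP[r0 r1]; rewrite /tau -mulrA mulr_ge0 ?(ltW r0)//=.
  by rewrite ler_piMr.
have hpos s : 0 < s <= delta0 -> 0 < hyp (nu + 1) (tau * s `^ m) by move=> /yt/pos.
have ratio_le0 s : 0 < s <= delta0 -> ratio (nu + 1) (tau * s `^ m) * (tau * s `^ m) <= 0.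
  move=> sd; have /andP[y0 y1] := yt s sd.
  move: y0; rewrite le_eqVlt => /predU1P[<-|y0]; first by rewrite mulr0.
  rewrite mulr_le0_ge0 ?(ltW y0)// /ratio mulr_le0_ge0 ?invr_ge0 ?(ltW (hpos s sd))//.
  by apply: (hyp'_le0 nu1 pos); rewrite y0.
rewrite two_weight_integral//.
apply: (@le_trans _ _ ((1 * (1 + `|la|))%:E *
   \int[mu]_(x in `[a, b]) (`|derive1 g x| ^+ 2)%:E)%E); last first.
  apply: lee_wpmul2r; first by apply: integral_ge0 => x _; rewrite lee_fin exprn_ge0.
  by rewrite lee_fin mul1r lerD2r; lra.
apply: (@hardy_of_profile R a b g (bessel_profile p m tau (nu + 1)) (bessel_profile' p m tau (nu + 1))
  (fun s => (p - p ^+ 2) / s ^+ 2 + br ^+ 2 / delta0 `^ m / s `^ (2 - m)) 1 p `|la|) => //.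
- exact: ltW.
- by move=> s sd; apply: is_derive_bessel_profile => //; [case/andP: sd|rewrite gt_eqF// hpos].
- by move=> s sd; apply: continuous_bessel_profile' => //; [case/andP: sd|rewrite gt_eqF// hpos].
- move=> s sd; rewrite mul_bessel_profile; last by case/andP: sd.
  have := mulr_ge0_le0 (ltW m0) (ratio_le0 s sd); lra.
(* the profile at the midpoint is [la / delta0], or [p / delta0] if [t = 0] *)
- rewrite mul_bessel_profile//; have -> : tau * delta0 `^ m = t by rewrite /tau /D mulfVK// gt_eqF.
  case: eq => [->|[{}t0 eq]].
    by rewrite mulr0 mul0r addr0 addr_ge0// ltW.
  have -> : p + m * t * ratio (nu + 1) t = la.
    have ht : hyp (nu + 1) t != 0 by rewrite gt_eqF// pos// lexx ltW.
    apply: (mulIf ht); rewrite /ratio; apply/eqP; rewrite -subr_eq0 -eq; apply/eqP; field.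
    by [].
  by have := ler_norm (- la); rewrite normrN; lra.
- exact: measurable_weight.
- move=> s /andP[s0 _]; rewrite addr_ge0// divr_ge0 ?powR_ge0 ?sqr_ge0//.
- move=> s sd; have [s0 _] := andP sd.
  have s20 : 0 < s ^+ 2 by rewrite exprn_gt0.
  have hs : hyp (nu + 1) (tau * s `^ m) != 0 by rewrite gt_eqF// hpos.
  rewrite mul1r -(pmulr_rle0 _ s20) mulrDr bessel_profile_riccati//; last 2 first.
  - by rewrite /p; field; rewrite gt_eqF.
  - by rewrite gt_eqF.
  have -> : s ^+ 2 * ((p - p ^+ 2) / s ^+ 2 + br ^+ 2 / delta0 `^ m / s `^ (2 - m)) =
      p - p ^+ 2 + br ^+ 2 * (D * s `^ m).
    rewrite -[2 - m]opprB powRN invrK (powR_m m s0) -/D.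
    by field; rewrite gt_eqF.
  have /andP[r0 _] := powR_ratio m0 sd.
  have := ler_wpM2r (ltW r0) bt; rewrite -/D /tau; lra.
Qed.
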